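(* Let $(Y,B)$ be an extension of a Hilbert bimodule $(X,A)$. Then the short exact sequence of Hilbert bimodules $$0\longrightarrow(X,A)\xrightarrow{(\psi_X,\psi_A)}(Y,B)\xrightarrow{(q_Y,q_B)}(Y/X,B/A)\longrightarrow0$$ induces a short exact sequence of Cuntz-Pimsner algebras $$0\longrightarrow\mathcal O_X\xrightarrow{\ \Psi\ }\mathcal O_Y\xrightarrow{\ Q\ }\mathcal O_{Y/X}\longrightarrow0,$$ where $\Psi$ and $Q$ are the homomorphisms induced by $(\psi_X,\psi_A)$ and $(q_Y,q_B)$ respectively. Consequently, there is an isomorphism $\mathcal O_{Y/X}\cong\mathcal O_Y/\mathcal O_X$.
   Context: For a $C^*$-algebra $A$, a right Hilbert $A$-module is a Banach space $X$ with a non-degenerate right action of $A$ and an $A$-valued inner product $\langle\cdot,\cdot\rangle_X$ with $\langle \xi,\eta a\rangle_X=\langle\xi,\eta\rangle_X a$, $\langle\eta,\xi\rangle_X=\langle\xi,\eta\rangle_X^*$, $\langle\xi,\xi\rangle_X\ge 0$ and $\|\xi\|=\|\langle\xi,\xi\rangle_X\|^{1/2}$. A left Hilbert $A$-module is a Banach space with a non-degenerate left action of $A$ and an $A$-valued inner product ${}_X\langle\cdot,\cdot\rangle$ with ${}_X\langle a\xi,\eta\rangle=a\,{}_X\langle\xi,\eta\rangle$, ${}_X\langle\eta,\xi\rangle={}_X\langle\xi,\eta\rangle^*$, ${}_X\langle\xi,\xi\rangle\ge0$ and $\|\xi\|=\|{}_X\langle\xi,\xi\rangle\|^{1/2}$.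 The pair $(X,A)$ is a Hilbert bimodule if $X$ is simultaneously a left and a right Hilbert $A$-module and ${}_X\langle\xi,\eta\rangle\zeta=\xi\langle\eta,\zeta\rangle_X$ for all $\xi,\eta,\zeta\in X$. A morphism $(X,A)\to(Y,B)$ of Hilbert bimodules is a pair $(\psi_X,\psi_A)$ with $\psi_X:X\to Y$ linear and $\psi_A:A\to B$ a $*$-homomorphism such that $\psi_X(\xi a)=\psi_X(\xi)\psi_A(a)$, $\psi_X(a\xi)=\psi_A(a)\psi_X(\xi)$, $\psi_A(\langle\xi,\eta\rangle_X)=\langle\psi_X(\xi),\psi_X(\eta)\rangle_Y$ and $\psi_A({}_X\langle\xi,\eta\rangle)={}_Y\langle\psi_X(\xi),\psi_X(\eta)\rangle$. An ideal $I$ (closed, two-sided) of $A$ is invariant with respect to $X$ if $IX=XI$. A Hilbert bimodule $(Y,B)$ is an extension of $(X,A)$ if $B$ is a $C^*$-algebra containing $A$ as an ideal, there is a morphism of Hilbert bimodules $(\psi_X,\psi_A):(X,A)\to(Y,B)$ such that $\psi_A$ is the inclusion of $A$ in $B$, and $A$ is invariant with respect to $Y$. The quotient $(Y/X,B/A)$ (where $Y/X$ means $Y/\psi_X(X)$) is regarded as a Hilbert bimodule with the actions and inner products induced from $(Y,B)$, and $(q_Y,q_B)$ is the pair of quotient maps, a morphism of Hilbert bimodules. Any $C^*$-algebra $D$ gives a Hilbert bimodule $(D,D)$ with actions by multiplication, ${}_D\langle a,b\rangle=ab^*$ and $\langle a,b\rangle_D=a^*b$. A covariant representation of $(X,A)$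 on $D$ is a morphism $(t_X,t_A):(X,A)\to(D,D)$. The Cuntz-Pimsner algebra $\mathcal O_X$ is the universal $C^*$-algebra generated by covariant representations of $(X,A)$; its universal covariant representation is denoted $(T_X,T_A)$. A morphism $(\psi_X,\psi_A):(X,A)\to(Y,B)$ induces a unique $*$-homomorphism $\Psi:\mathcal O_X\to\mathcal O_Y$ with $\Psi\circ T_X=T_Y\circ\psi_X$ and $\Psi\circ T_A=T_B\circ\psi_A$. In $\mathcal O_Y/\mathcal O_X$, the algebra $\mathcal O_X$ is identified with $\Psi(\mathcal O_X)$. *)

(* Defs.v *)
From HB Require Import structures.
From mathcomp Require Import all_boot all_order all_algebra.
From mathcomp Require Import complex.
From mathcomp Require Import boolp classical_sets functions reals.
From mathcomp Require Import topology normedtype.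

Set Implicit Arguments.
Unset Strict Implicit.
Unset Printing Implicit Defensive.

Import Order.TTheory GRing.Theory Num.Theory.
Import numFieldNormedType.Exports.

Local Open Scope classical_set_scope.
Local Open Scope ring_scope.
Local Open Scope complex_scope.

(* C*-algebras need not have a unit, so the product is not that of a MathComp
   ring.  Scalars are R[i], where norms also take their values. *)
HB.mixin Record isCstarAlgebra (R : realType) A
    of CompleteNormedModule R[i] A := {
  cmul : A -> A -> A;
  star : A -> A;
  cmulA : associative cmul;
  cmul_linearl : forall b, linear (cmul^~ b);
  cmul_linearr : forall a, linear (cmul a);
  cmul_norm : forall a b, `|cmul a b| <= `|a| * `|b|;
  starK : involutive star;
  starM : forall a b, star (cmul a b) = cmul (star b) (star a);
  star_antilinear : forall (k : R[i]) a b,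
    star (k *: a + b) = Num.conj k *: star a + star b;
  cstar_norm : forall a, `|cmul (star a) a| = `|a| ^+ 2 }.

#[short(type="cstarAlgType")]
HB.structure Definition CstarAlgebra (R : realType) :=
  {A of isCstarAlgebra R A & CompleteNormedModule R[i] A}.

Section CstarNotions.
Context {R : realType}.

Definition linear_subspace (V : completeNormedModType R[i]) (F : set V) : Prop :=
  F 0 /\ forall (k : R[i]) u v, F u -> F v -> F (k *: u + v).

Definition closed_span (V : completeNormedModType R[i]) (S : set V) : set V :=
  smallest [set F | closed F /\ linear_subspace F] S.

Definition cstar_pos (A : cstarAlgType R) (a : A) : Prop :=
  exists b : A, a = cmul (star b) b.

Definition cstar_subalgebra (A : cstarAlgType R) (S : set A) : Prop :=
  [/\ closed S, linear_subspace S,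
      forall a b, S a -> S b -> S (cmul a b) &
      forall a, S a -> S (star a)].

Definition cstar_ideal (A : cstarAlgType R) (I : set A) : Prop :=
  [/\ closed I, linear_subspace I,
      forall a b, I b -> I (cmul a b) &
      forall a b, I a -> I (cmul a b)].

Definition star_hom (A B : cstarAlgType R) (f : A -> B) : Prop :=
  [/\ linear f,
      forall a b, f (cmul a b) = cmul (f a) (f b) &
      forall a, f (star a) = star (f a)].

Definition cstar_isomorphic (A B : cstarAlgType R) : Prop :=
  exists2 f : A -> B, star_hom f & bijective f.

(* (W, q) is the normed quotient V/N: the last two clauses say that the norm
   of q v is the infimum of `|v - n| over n in N. *)
Definition quotient_map (V W : completeNormedModType R[i])
    (N : set V) (q : V -> W) : Prop :=
  [/\ linear q, range q = setT, q @^-1` [set 0] = N,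
      forall v n, N n -> `|q v| <= `|v - n| &
      forall v (e : R[i]), 0 < e -> exists2 n, N n & `|v - n| < `|q v| + e].

Definition cstar_quotient (A D : cstarAlgType R) (I : set A) (p : A -> D) : Prop :=
  [/\ cstar_ideal I, star_hom p & quotient_map I p].

Definition cstar_short_exact (A B D : cstarAlgType R)
    (f : A -> B) (g : B -> D) : Prop :=
  [/\ star_hom f /\ star_hom g,
      injective f, range f = g @^-1` [set 0] & range g = setT].

End CstarNotions.

HB.mixin Record isRightHilbertModule (R : realType) (A : cstarAlgType R) X
    of CompleteNormedModule R[i] X := {
  ract : X -> A -> X;
  rip : X -> X -> A;
  ract_linearl : forall a, linear (ract^~ a);
  ract_linearr : forall x, linear (ract x);
  ractA : forall x a b, ract (ract x a) b = ract x (cmul a b);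
  ract_nondegenerate :
    closed_span [set ract x a | x in [set: X] & a in [set: A]] = setT;
  rip_linear : forall x, linear (rip x);
  rip_ract : forall x y a, rip x (ract y a) = cmul (rip x y) a;
  rip_star : forall x y, rip y x = star (rip x y);
  rip_pos : forall x, cstar_pos (rip x x);
  rip_norm : forall x, `|x| = sqrtC `|rip x x| }.

HB.mixin Record isLeftHilbertModule (R : realType) (A : cstarAlgType R) X
    of CompleteNormedModule R[i] X := {
  lact : A -> X -> X;
  lip : X -> X -> A;
  lact_linearl : forall x, linear (lact^~ x);
  lact_linearr : forall a, linear (lact a);
  lactA : forall a b x, lact a (lact b x) = lact (cmul a b) x;
  lact_nondegenerate :
    closed_span [set lact a x | a in [set: A] & x in [set: X]] = setT;
  lip_linear : forall y, linear (lip^~ y);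
  lip_lact : forall a x y, lip (lact a x) y = cmul a (lip x y);
  lip_star : forall x y, lip y x = star (lip x y);
  lip_pos : forall x, cstar_pos (lip x x);
  lip_norm : forall x, `|x| = sqrtC `|lip x x| }.

#[short(type="rightHilbertModType")]
HB.structure Definition RightHilbertModule (R : realType) (A : cstarAlgType R) :=
  {X of isRightHilbertModule R A X & CompleteNormedModule R[i] X}.

#[short(type="leftHilbertModType")]
HB.structure Definition LeftHilbertModule (R : realType) (A : cstarAlgType R) :=
  {X of isLeftHilbertModule R A X & CompleteNormedModule R[i] X}.

HB.mixin Record isHilbertBimodule (R : realType) (A : cstarAlgType R) X
    of RightHilbertModule R A X & LeftHilbertModule R A X := {
  lip_rip : forall x y z : X, lact (lip x y : A) z = ract x (rip y z : A) }.

#[short(type="hilbertBimodType")]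
HB.structure Definition HilbertBimodule (R : realType) (A : cstarAlgType R) :=
  {X of isHilbertBimodule R A X
      & RightHilbertModule R A X & LeftHilbertModule R A X}.

Section BimoduleNotions.
Context {R : realType}.

Definition bimod_morphism (A B : cstarAlgType R)
    (X : hilbertBimodType A) (Y : hilbertBimodType B)
    (psiX : X -> Y) (psiA : A -> B) : Prop :=
  [/\ linear psiX /\ star_hom psiA,
      forall x a, psiX (ract x a) = ract (psiX x) (psiA a),
      forall a x, psiX (lact a x) = lact (psiA a) (psiX x),
      forall x y, psiA (rip x y) = rip (psiX x) (psiX y) &
      forall x y, psiA (lip x y) = lip (psiX x) (psiX y)].

(* IX and XI are closed linear spans, as is usual for products of subspaces;
   by the Cohen-Hewitt factorization theorem they are also the plain sets of
   products. *)
Definition ideal_lact (A : cstarAlgType R) (X : hilbertBimodType A)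
    (I : set A) : set X :=
  closed_span [set lact a x | a in I & x in [set: X]].

Definition ideal_ract (A : cstarAlgType R) (X : hilbertBimodType A)
    (I : set A) : set X :=
  closed_span [set ract x a | x in [set: X] & a in I].

Arguments ideal_lact {A} X I.
Arguments ideal_ract {A} X I.

Definition ideal_invariant (A : cstarAlgType R) (X : hilbertBimodType A)
    (I : set A) : Prop :=
  ideal_lact X I = ideal_ract X I.

(* The inclusion of A in B is an isometric *-homomorphism onto an ideal; A is
   identified with its range. *)
Definition bimod_extension (A B : cstarAlgType R)
    (X : hilbertBimodType A) (Y : hilbertBimodType B)
    (psiX : X -> Y) (psiA : A -> B) : Prop :=
  [/\ bimod_morphism psiX psiA,
      forall a, `|psiA a| = `|a|,
      cstar_ideal (range psiA) &
      ideal_invariant Y (range psiA)].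

(* (Z, E) with (qY, qB) is the quotient (Y/X, B/A): that (qY, qB) is a morphism
   says that the actions and inner products of (Z, E) are those induced from
   (Y, B). *)
Definition bimod_quotient (A B E : cstarAlgType R)
    (X : hilbertBimodType A) (Y : hilbertBimodType B) (Z : hilbertBimodType E)
    (psiX : X -> Y) (psiA : A -> B) (qY : Y -> Z) (qB : B -> E) : Prop :=
  [/\ bimod_morphism qY qB,
      quotient_map (range psiX) qY &
      cstar_quotient (range psiA) qB].

(* A morphism (X, A) -> (D, D), the Hilbert bimodule structure of D (products as
   actions, a b^* and a^* b as inner products) being written out. *)
Definition covariant_rep (A : cstarAlgType R) (X : hilbertBimodType A)
    (D : cstarAlgType R) (tX : X -> D) (tA : A -> D) : Prop :=
  [/\ linear tX /\ star_hom tA,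
      forall x a, tX (ract x a) = cmul (tX x) (tA a),
      forall a x, tX (lact a x) = cmul (tA a) (tX x),
      forall x y, tA (rip x y) = cmul (star (tX x)) (tX y) &
      forall x y, tA (lip x y) = cmul (tX x) (star (tX y))].

Definition cuntz_pimsner (A : cstarAlgType R) (X : hilbertBimodType A)
    (O : cstarAlgType R) (TX : X -> O) (TA : A -> O) : Prop :=
  [/\ covariant_rep TX TA,
      smallest (@cstar_subalgebra R O) (range TX `|` range TA) = setT &
      forall (D : cstarAlgType R) (tX : X -> D) (tA : A -> D),
        covariant_rep tX tA ->
        exists Phi : O -> D, [/\ star_hom Phi, Phi \o TX = tX & Phi \o TA = tA]].

Definition induced_hom (A B : cstarAlgType R)
    (X : hilbertBimodType A) (Y : hilbertBimodType B) (OX OY : cstarAlgType R)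
    (TX : X -> OX) (TA : A -> OX) (TY : Y -> OY) (TB : B -> OY)
    (psiX : X -> Y) (psiA : A -> B) (Psi : OX -> OY) : Prop :=
  unique (fun F : OX -> OY =>
    [/\ star_hom F, F \o TX = TY \o psiX & F \o TA = TB \o psiA]) Psi.

End BimoduleNotions.

(* Main.v *)
(** The inner products of the quotient bimodule force [X = YA = AY] inside [Y].
    Hence [Y] acts on [OX] by multipliers: [y (T_A(a) z) = T_X(ya) z] extends
    the universal representation of [X] to a covariant representation of
    [(Y, B)] on the multiplier algebra of [OX].  The resulting homomorphism
    from [OY] restricts along [Psi] to the inclusion of [OX] in its multiplier
    algebra, so [Psi] is bounded below; its range [N] is then closed, and an
    ideal.  For any quotient [D] of [OY] by [N] the maps [Y -> OY -> D] and
    [B -> OY -> D] factor through a covariant representation of [Z = Y/X],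
    which gives an inverse [OZ -> D] of the map [D -> OZ] induced by [Q].

    The analysis needs neither spectra nor positivity.  A self-adjoint [x] of
    norm at most [1/2] is the real part of a unitary [x + i (1 - g)] of the
    unitization, with [g = 1 - sqrt (1 - x^2)] obtained as a fixed point.  This
    bounds the star homomorphisms and the action of [B] on [OX], and the ergodic
    means of the powers of such a unitary replace approximate units in the proof
    that the quotient norm is a C*-norm. *)

(* The usual facts that injective star homomorphisms are isometric and that ranges of star
   homomorphisms are closed rest on the functional calculus. Their substitute is the bound
   [nm (f a) <= 2 * nm a], proved for every star homomorphism. Applied to the map from [OY] to the
   multipliers of [OX], it bounds [Psi] below, which yields injectivity and closed range at once.
   The factor 2 is not sharp: it comes from scaling self-adjoint elements into the ball of radius
   1/2, where the fixed point equation for [g] is contractive. The universal property quantifies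
   over C*-algebras, so the multipliers and the quotient by [N] have to be built as complete
   C*-algebras before it can be applied to them. A product [y a] lies in [X] because its image
   [qY y * qB a] vanishes and the kernel of [qY] is [X]. Surjectivity of [Q] is read off from the
   inverse [OZ -> D] and not from a closed range argument. *)
Require Import Defs.
From HB Require Import structures.
From mathcomp Require Import all_boot all_order all_algebra.
From mathcomp Require Import complex lra generic_quotient.
From mathcomp Require Import boolp classical_sets functions reals.
From mathcomp Require Import topology normedtype.

Set Implicit Arguments.
Unset Strict Implicit.
Unset Printing Implicit Defensive.

Import Order.TTheory GRing.Theory Num.Theory.
Import numFieldNormedType.Exports.

Local Open Scope classical_set_scope.
Local Open Scope ring_scope.
Local Open Scope complex_scope.
Local Open Scope quotient_scope.

(** * Real norms and completeness *)

Section RealNorm.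
Context {R : realType} {V : normedModType R[i]}.
Implicit Types (u v w : V) (k : R[i]).

(** Norms take their values in [R[i]], whose order is partial. The real part loses nothing ([nmE])
    and gives access to [lra], infima and square roots. *)
Definition nm v : R := complex.Re `|v|.

Lemma nmE v : `|v| = (nm v)%:C.
Proof. by rewrite /nm RRe_real// ger0_real. Qed.

Lemma nm_ge0 v : 0 <= nm v.
Proof. by rewrite -ler0c -nmE. Qed.

Lemma nm0 : nm 0 = 0.
Proof. by rewrite /nm normr0. Qed.

Lemma nm_eq0 v : nm v = 0 -> v = 0.
Proof. by move=> v0; apply/eqP; rewrite -normr_eq0 nmE v0. Qed.

Lemma nm_le0 v : nm v <= 0 -> v = 0.
Proof. by move=> v0; apply: nm_eq0; apply/eqP; rewrite eq_le v0 nm_ge0. Qed.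

Lemma nmN v : nm (- v) = nm v.
Proof. by rewrite /nm normrN. Qed.

Lemma nmD u v : nm (u + v) <= nm u + nm v.
Proof. by rewrite -lecR -nmE (le_trans (ler_normD _ _))// !nmE -rmorphD. Qed.

Lemma nmB u v : nm (u - v) <= nm u + nm v.
Proof. by rewrite -[nm v]nmN nmD. Qed.

Lemma nm_dist u v : nm (u - v) = nm (v - u).
Proof. by rewrite -nmN opprB. Qed.

Lemma nm_tri w u v : nm (u - v) <= nm (u - w) + nm (w - v).
Proof. by rewrite (le_trans _ (nmD _ _))// addrA subrK. Qed.

Lemma nmZ k v : nm (k *: v) = complex.Re `|k| * nm v.
Proof.
apply: (@complexI R); rewrite -nmE normrZ nmE.
by rewrite -{1}(RRe_real (ger0_real (normr_ge0 k))) -rmorphM.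
Qed.

Lemma nmZr (r : R) v : 0 <= r -> nm (r%:C *: v) = r * nm v.
Proof. by move=> r0; rewrite nmZ ger0_norm// ler0c. Qed.

Lemma nm_small v : (forall e : R, 0 < e -> nm v < e) -> v = 0.
Proof.
move=> h; apply: nm_le0; rewrite leNgt; apply/negP => v0.
by have := h _ v0; rewrite ltxx.
Qed.

Lemma closed_nm (S : set V) : closed S ->
  forall v, (forall e : R, 0 < e -> exists2 u, S u & nm (v - u) < e) -> S v.
Proof.
move=> cS v h; apply: cS => B /nbhs_ballP[e e0 eB].
have er : e = (complex.Re e)%:C by rewrite RRe_real// gtr0_real.
have [|u Su uv] := h (complex.Re e); first by rewrite -ltcR -er.
exists u; split=> //; apply: eB; rewrite -ball_normE /ball_ /=.
by rewrite nmE er ltcR.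
Qed.

Lemma nm_closed (S : set V) :
  (forall v, (forall e : R, 0 < e -> exists2 u, S u & nm (v - u) < e) -> S v) ->
  closed S.
Proof.
move=> h v cv; apply: h => e e0.
have : nbhs v (ball v e%:C) by apply: nbhsx_ballx; rewrite ltcR.
move=> /cv[u [Su]]; rewrite -ball_normE /ball_ /= nmE ltcR => uv.
by exists u.
Qed.

(** Geometric steps give limits with explicit error bounds, so that later completeness arguments
    handle sequences and not filters. *)
Definition fast_cauchy (u : nat -> V) :=
  forall n, nm (u n.+1 - u n) <= 2^-1 ^+ n.

Lemma half_expS n : (2^-1 : R) ^+ n = 2 * 2^-1 ^+ n.+1.
Proof. by rewrite exprS mulrA divff ?mul1r// pnatr_eq0. Qed.

Lemma half_exp_gt0 n : 0 < (2^-1 : R) ^+ n.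
Proof. by rewrite exprn_gt0// invr_gt0 ltr0n. Qed.

Lemma half_exp_small (e : R) : 0 < e -> exists n, 2^-1 ^+ n < e.
Proof.
move=> e0; exists (Num.truncn e^-1).+1.
rewrite exprVn invf_plt ?posrE ?exprn_gt0 ?ltr0n//.
rewrite (lt_trans (truncnS_gt _))//.
by rewrite -natrX ltr_nat ltn_expl.
Qed.

Lemma fast_cauchy_dist (u : nat -> V) : fast_cauchy u ->
  forall n m, nm (u (n + m)%N - u n) <= 2 * 2^-1 ^+ n - 2 * 2^-1 ^+ (n + m).
Proof.
move=> fu n; elim=> [|m IH]; first by rewrite addn0 !subrr nm0.
have := fu (n + m)%N; have := nm_tri (u (n + m)%N) (u (n + m.+1)%N) (u n).
by rewrite addnS; have := half_expS (n + m); lra.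
Qed.

(** A Cauchy filter contains sets of diameter at most [2^-1 ^+ n]; points chosen in their finite
    intersections form a fast sequence, whose limit is that of the filter. The error allowed is 4,
    twice what a complete space gives, to leave room for the lifting used in quotients. *)
Lemma fast_cauchy_cvg_complete :
  (forall u : nat -> V, fast_cauchy u ->
     exists l, forall n, nm (l - u n) <= 4 * 2^-1 ^+ n) ->
  forall F : set_system V, ProperFilter F -> cauchy F -> cvg F.
Proof.
move=> h F FF /cauchyP cF.
have P n : {S : set V | F S & forall x y, S x -> S y -> nm (x - y) <= 2^-1 ^+ n}.
  apply: cid2; have [|x Fx] := cF ((2^-1 ^+ n.+1 : R)%:C).
    by rewrite ltcR half_exp_gt0.
  exists (ball x (2^-1 ^+ n.+1 : R)%:C) => // y z.
  rewrite -ball_normE /ball_ /= !nmE !ltcR => xy xz.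
  have := nm_tri x y z; rewrite (nm_dist y x) (half_expS n).
  by lra.
(* One point in all of the first sets, so that [u n] and [u n.+1] both lie in [P n]. *)
have ex n : exists x, forall i : 'I_n.+1, s2val (P i) x.
  by apply: (@filter_ex _ F); apply: filter_forall => i; exact: s2valP (P i).
pose u n := projT1 (cid (ex n)).
have uP n i : (i <= n)%N -> s2val (P i) (u n).
  rewrite -ltnS => ni.
  exact: (projT2 (cid (ex n)) (Ordinal ni)).
have [|l hl] := h u.
  by move=> n; apply: (s2valP' (P n)); apply: uP.
apply/cvg_ex; exists l; apply/cvg_ballP => e e0.
have er : e = (complex.Re e)%:C by rewrite RRe_real// gtr0_real.
(* 5 is 4 for the distance from [l] to [u n] plus 1 for the diameter of [P n]. *)
have [|n ne] := @half_exp_small (complex.Re e / 5).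
  by rewrite divr_gt0 ?ltr0n// -ltcR -er.
near=> x; rewrite -ball_normE /ball_ /= nmE er ltcR.
have xn : nm (u n - x) <= 2^-1 ^+ n.
  apply: (s2valP' (P n)); first exact: uP.
  by near: x; exact: s2valP (P n).
by have := nm_tri (u n) l x; have := hl n; lra.
Unshelve. all: by end_near. Qed.

End RealNorm.

Lemma fast_cauchy_cvg {R : realType} {V : completeNormedModType R[i]}
    (u : nat -> V) : fast_cauchy u ->
  exists l, forall n, nm (l - u n) <= 2 * 2^-1 ^+ n.
Proof.
move=> fu.
have cF : cauchy (u @ \oo).
  apply/cauchyP => e e0.
  have er : e = (complex.Re e)%:C by rewrite RRe_real// gtr0_real.
  have [|n ne] := @half_exp_small R (complex.Re e / 2).
    by rewrite divr_gt0 ?ltr0n// -ltcR -er.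
  exists (u n); exists n => //= m /= nm0.
  rewrite -ball_normE /ball_ /= nmE er ltcR.
  have := fast_cauchy_dist fu n (m - n); rewrite subnKC// nm_dist.
  by have := @half_exp_gt0 R m; lra.
have [l ul] := iffLR (cvg_ex _) (cauchy_cvg _ cF).
exists l => n; rewrite leNgt; apply/negP => lun.
pose e := nm (l - u n) - 2 * 2^-1 ^+ n.
have /cvg_ballP/(_ e%:C) : u @ \oo --> l by [].
case; first by rewrite ltcR /e; lra.
move=> m _ /(_ (n + m)%N); rewrite /= leq_addl => /(_ isT).
rewrite -ball_normE /ball_ /= nmE ltcR /e.
have := fast_cauchy_dist fu n m; have := nm_tri (u (n + m)%N) l (u n).
by have := @half_exp_gt0 R (n + m); lra.
Qed.

(** * C*-algebras *)

Section LinearMaps.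
Context {K : pzRingType} {V W : lmodType K} {f : V -> W}.
Hypothesis linf : linear f.

Lemma lin0 : f 0 = 0.
Proof. by have := linf (-1) 0 0; rewrite scaler0 add0r scaleN1r addNr. Qed.

Lemma linD u v : f (u + v) = f u + f v.
Proof. by have := linf 1 u v; rewrite !scale1r. Qed.

Lemma linZ k u : f (k *: u) = k *: f u.
Proof. by have := linf k u 0; rewrite !addr0 lin0 addr0. Qed.

Lemma linN u : f (- u) = - f u.
Proof. by rewrite -scaleN1r linZ scaleN1r. Qed.

Lemma linB u v : f (u - v) = f u - f v.
Proof. by rewrite linD linN. Qed.

End LinearMaps.

Section CstarBasics.
Context {R : realType} {A : cstarAlgType R}.
Implicit Types (a b c : A) (k : R[i]).

Lemma cmulDl a b c : cmul (a + b) c = cmul a c + cmul b c.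
Proof. exact: (linD (cmul_linearl c)). Qed.
Lemma cmulDr c a b : cmul c (a + b) = cmul c a + cmul c b.
Proof. exact: (linD (cmul_linearr c)). Qed.
Lemma cmulNl a b : cmul (- a) b = - cmul a b.
Proof. exact: (linN (cmul_linearl b)). Qed.
Lemma cmulNr a b : cmul a (- b) = - cmul a b.
Proof. exact: (linN (cmul_linearr a)). Qed.
Lemma cmulBl a b c : cmul (a - b) c = cmul a c - cmul b c.
Proof. exact: (linB (cmul_linearl c)). Qed.
Lemma cmulBr c a b : cmul c (a - b) = cmul c a - cmul c b.
Proof. exact: (linB (cmul_linearr c)). Qed.
Lemma cmulZl k a b : cmul (k *: a) b = k *: cmul a b.
Proof. exact: (linZ (cmul_linearl b)). Qed.
Lemma cmulZr k a b : cmul a (k *: b) = k *: cmul a b.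
Proof. exact: (linZ (cmul_linearr a)). Qed.
Lemma cmul0l a : cmul 0 a = 0.
Proof. exact: (lin0 (cmul_linearl a)). Qed.
Lemma cmul0r a : cmul a 0 = 0.
Proof. exact: (lin0 (cmul_linearr a)). Qed.

Lemma starD a b : star (a + b) = star a + star b.
Proof. by have := star_antilinear 1 a b; rewrite rmorph1 !scale1r. Qed.
Lemma star0 : star (0 : A) = 0.
Proof. by apply: (addrI (star (0 : A))); rewrite -starD !addr0. Qed.
Lemma starZ k a : star (k *: a) = Num.conj k *: star a.
Proof. by have := star_antilinear k a 0; rewrite !addr0 star0 addr0. Qed.
Lemma starN a : star (- a) = - star a.
Proof. by rewrite -scaleN1r starZ rmorphN rmorph1 scaleN1r. Qed.
Lemma starB a b : star (a - b) = star a - star b.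
Proof. by rewrite starD starN. Qed.

Lemma nm_cmul a b : nm (cmul a b) <= nm a * nm b.
Proof. by rewrite -lecR rmorphM/= -!nmE cmul_norm. Qed.

Lemma nm_cstar a : nm (cmul (star a) a) = nm a ^+ 2.
Proof. by apply: (@complexI R); rewrite rmorphXn/= -!nmE cstar_norm. Qed.

Lemma nm_cstar_eq a b :
  cmul (star a) a = cmul (star b) b -> nm a = nm b.
Proof.
move=> ab; apply/eqP.
by rewrite -(@eqrXn2 _ 2)// ?nm_ge0// -!nm_cstar ab.
Qed.

Lemma cstar_eq0 a : cmul (star a) a = 0 -> a = 0.
Proof.
move=> a0; apply: nm_eq0; apply/eqP.
by rewrite -[_ == _](@expf_eq0 R _ 2) -nm_cstar a0 nm0.
Qed.

Lemma sqr_le_nm (x y : R) : 0 <= x -> 0 <= y -> x ^+ 2 <= y * x -> x <= y.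
Proof.
rewrite expr2 le_eqVlt => /predU1P[<-//|x0] _.
by rewrite ler_pM2r.
Qed.

Lemma nm_star a : nm (star a) = nm a.
Proof.
have h b : nm b <= nm (star b).
  apply: sqr_le_nm; rewrite ?nm_ge0// -nm_cstar; exact: nm_cmul.
by apply/eqP; rewrite eq_le h andbT -{2}[a]starK h.
Qed.

Lemma nm_cstarr a : nm (cmul a (star a)) = nm a ^+ 2.
Proof. by rewrite -{1}(starK a) nm_cstar nm_star. Qed.

(* [p] and [q] are the images of [z] under the cosine and the sine of a unitary
   operator. *)
Lemma nm_unitary (z p q : A) :
  cmul (star p) p + cmul (star q) q = cmul (star z) z ->
  cmul (star p) q = cmul (star q) p ->
  nm (p + 'i *: q) = nm z.
Proof.
move=> pqz pq; apply: nm_cstar_eq; rewrite -pqz.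
rewrite starD starZ conjCi cmulDl !cmulDr !cmulZl !cmulZr pq scalerA.
by rewrite mulNr -expr2 sqrCi opprK scale1r scaleNr -addrA addNKr.
Qed.

(** [p] is the half sum of [p + 'i *: q] and [p - 'i *: q], both of norm [nm z]. *)
Lemma nm_le_unitary (z p q : A) :
  cmul (star p) p + cmul (star q) q = cmul (star z) z ->
  cmul (star p) q = cmul (star q) p -> nm p <= nm z.
Proof.
move=> pqz pq; have h := nm_unitary pqz pq.
have h' : nm (p + 'i *: - q) = nm z.
  by apply: nm_unitary; rewrite ?starN ?cmulNl ?cmulNr ?opprK// pq.
have := nmD (p + 'i *: q) (p + 'i *: - q).
rewrite h h' scalerN addrACA subrr addr0 -mulr2n -scaler_nat.
rewrite -(rmorph_nat (real_complex R)) nmZr ?ler0n//.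
by lra.
Qed.

End CstarBasics.

Section HalfSine.
Context {R : realType} {A : cstarAlgType R}.
Variable x : A.
Hypotheses (sx : star x = x) (x1 : nm x <= 2^-1).

Let half (a : A) : A := (2^-1 : R)%:C *: a.

Let halfK a : half a + half a = a.
Proof.
rewrite /half -scalerDl -rmorphD/= -mulr2n -[_ *+ 2]mulr_natl divff.
  by rewrite rmorph1 scale1r.
by rewrite pnatr_eq0.
Qed.

Let nm_half a : nm (half a) = 2^-1 * nm a.
Proof. by rewrite /half nmZr// invr_ge0 ler0n. Qed.

Let F g : A := half (cmul x x + cmul g g).
Let u n := iter n F 0.

Let uP n : [/\ star (u n) = u n, cmul (u n) x = cmul x (u n) & nm (u n) <= 2^-1].
Proof.
elim: n => [|n [IH1 IH2 IH3]].
  by rewrite /= star0 cmul0l cmul0r nm0 invr_ge0 ler0n.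
rewrite /u iterS -/(u n) /F; split.
- rewrite /half starZ starD !starM sx IH1; congr (_ *: _).
  by rewrite -[RHS](conjc_real (2^-1 : R)).
- rewrite /half cmulZl cmulZr cmulDl cmulDr -!cmulA; congr (_ *: (_ + _)).
  by rewrite IH2 !cmulA IH2.
- have := nmD (cmul x x) (cmul (u n) (u n)).
  have := nm_cmul x x; have := nm_cmul (u n) (u n); rewrite nm_half.
  have := ler_pM (nm_ge0 x) (nm_ge0 x) x1 x1.
  by have := ler_pM (nm_ge0 _) (nm_ge0 _) IH3 IH3; lra.
Qed.

(* [g] is [1 - sqrt (1 - x^2)], the fixed point of [g |-> (x^2 + g^2) / 2],
   which contracts the ball of radius [1/2] by the factor [1/2]. *)
Lemma one_minus_sine : exists g : A,
  [/\ star g = g, cmul g x = cmul x g & cmul x x + cmul g g = g + g].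
Proof.
have Fu n : u n.+1 = F (u n) by [].
have sqrB (a b : A) : cmul a a - cmul b b = cmul a (a - b) + cmul (a - b) b.
  by rewrite cmulBr cmulBl addrA subrK.
have dF (a b : A) : nm a <= 2^-1 -> nm b <= 2^-1 ->
    nm (F a - F b) <= 2^-1 * nm (a - b).
  move=> a1 b1; rewrite /F -scalerBr nm_half opprD addrACA subrr add0r sqrB.
  rewrite ler_pM2l ?invr_gt0 ?ltr0n// (le_trans (nmD _ _))//.
  rewrite (le_trans (lerD (nm_cmul _ _) (nm_cmul _ _)))//.
  have := ler_wpM2r (nm_ge0 (a - b)) a1.
  by have := ler_wpM2l (nm_ge0 (a - b)) b1; lra.
have fu : fast_cauchy u.
  elim=> [|n IH].
    rewrite expr0 subr0; case: (uP 1) => _ _ h; apply: le_trans h _.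
    by rewrite invf_le1 ?ler1n ?ltr0n.
  rewrite (Fu n.+1) {2}(Fu n) exprS.
  case: (uP n) (uP n.+1) => _ _ un [_ _ un1].
  by apply: le_trans (dF _ _ un1 un) _; rewrite ler_pM2l// invr_gt0 ltr0n.
have [g gu] := fast_cauchy_cvg fu.
(* Two consecutive iterates are needed to pass from [u n.+1 = F (u n)] to [F g = g]. *)
have app e : 0 < e -> exists n, nm (g - u n) < e /\ nm (g - u n.+1) < e.
  move=> e0; have [|n ne] := @half_exp_small R (e / 2); first by lra.
  exists n; have := gu n; have := gu n.+1; have := half_expS (R := R) n.
  by have := @half_exp_gt0 R n; lra.
exists g; split.
- apply/subr0_eq/nm_small => e e0; have [|n [gn _]] := app (e / 2); first by lra.
  case: (uP n) => sn _ _; have := nm_tri (u n) (star g) g.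
  by rewrite -{1}sn -starB nm_star (nm_dist (u n)); lra.
- apply/subr0_eq/nm_small => e e0; have [//|n [gn _]] := app e.
  case: (uP n) => _ cn _.
  have -> : cmul g x - cmul x g = cmul (g - u n) x - cmul x (g - u n).
    by rewrite cmulBl cmulBr cn opprB addrA subrK.
  have := nmB (cmul (g - u n) x) (cmul x (g - u n)).
  have := nm_cmul (g - u n) x; have := nm_cmul x (g - u n).
  by have := ler_wpM2l (nm_ge0 (g - u n)) x1; lra.
- have g1 : nm g <= 2^-1.
    rewrite leNgt; apply/negP => g2.
    have [|n [gn _]] := app (nm g - 2^-1); first by lra.
    case: (uP n) => _ _ un; have := nm_tri (u n) g 0.
    by rewrite !subr0; lra.
  suff Fg : F g = g by rewrite -[LHS]halfK -/(F g) Fg.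
  apply/subr0_eq/nm_small => e e0; have [|n [gn gn1]] := app (e / 2); first by lra.
  case: (uP n) => _ _ un; have := dF _ _ g1 un; rewrite -Fu => h.
  have := nm_tri (u n.+1) (F g) g; rewrite (nm_dist (u n.+1)).
  by lra.
Qed.

End HalfSine.

(** * Bounds for actions and for star homomorphisms *)

Lemma invS_small {R : realType} (e : R) : 0 < e -> exists m : nat, m.+1%:R^-1 < e.
Proof.
move=> e0; exists (Num.truncn e^-1).
by rewrite invf_plt ?posrE ?ltr0n// truncnS_gt.
Qed.

Lemma double_sub_cancel {V : zmodType} (t s w : V) :
  t + t - s + (w - t - (t - s)) = w.
Proof. by rewrite -[w - t - _]addrA -opprD [t + (t - s)]addrA addrCA subrr addr0. Qed.

(* [F a] plays the role of [a z] for an action of [A] by adjointable operators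
   on a Hilbert module over [D]. *)
Section ActionBound.
Context {R : realType} {A D : cstarAlgType R} {F : A -> D} {z : D}.
Hypotheses (linF : linear F)
  (FF : forall a b, cmul (star (F a)) (F b) = cmul (star z) (F (cmul (star a) b)))
  (Fz : forall a, cmul (star (F a)) z = cmul (star z) (F (star a))).

(** [F x] and [z - F g] stand for [x z] and [(1 - g) z]. The last relation between [x] and [g] says
    that [x^2 + (1 - g)^2 = 1], so these are the cosine and sine parts of a unitary applied to
    [z]. *)
Lemma action_unitary x g : star x = x -> star g = g -> cmul g x = cmul x g ->
    cmul x x + cmul g g = g + g ->
  cmul (star (F x)) (F x) + cmul (star (z - F g)) (z - F g) = cmul (star z) z /\
  cmul (star (F x)) (z - F g) = cmul (star (z - F g)) (F x).
Proof.
move=> sx sg gx xg; split.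
  rewrite FF sx starB cmulBl !cmulBr FF Fz !sg -(addrK (cmul g g) (cmul x x)) xg.
  rewrite (linB linF) (linD linF) cmulBr cmulDr.
  exact: double_sub_cancel.
by rewrite cmulBr starB cmulBl !FF Fz sx sg gx.
Qed.

(** A self-adjoint element scaled to norm 1/2 is the cosine part of a unitary and maps [z] to a
    vector of norm at most [nm z]; undoing the scaling costs the factor 2. The general case follows
    from the self-adjoint element [cmul (star a) a]. *)
Lemma action_bound a : nm (F a) <= 2 * nm a * nm z.
Proof.
have sa_bound x : star x = x -> nm (F x) <= 2 * nm x * nm z.
  move=> sx; have [x0|x0] := eqVneq (nm x) 0.
    by rewrite (nm_eq0 x0) (lin0 linF) !nm0 mulr0 mul0r.
  have {}x0 : 0 < nm x by rewrite lt_def x0 nm_ge0.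
  pose t := 2^-1 / nm x.
  have t0 : 0 < t by rewrite divr_gt0 ?invr_gt0 ?ltr0n.
  pose y := t%:C *: x.
  have sy : star y = y.
    by rewrite /y starZ sx; congr (_ *: _); exact: conjc_real.
  have y1 : nm y <= 2^-1 by rewrite nmZr ?(ltW t0)// divfK ?gt_eqF.
  have [g [sg gy yg]] := one_minus_sine sy y1.
  have [h1 h2] := action_unitary sy sg gy yg.
  have := nm_le_unitary h1 h2.
  rewrite /y (linZ linF) nmZr ?(ltW t0)// /t mulrAC ler_pdivrMr//.
  by lra.
have sqr_le u v : 0 <= u -> 0 <= v -> u ^+ 2 <= v ^+ 2 -> u <= v :> R.
  by move=> u0 v0; rewrite ler_sqr.
apply: sqr_le; rewrite ?mulr_ge0 ?nm_ge0// -nm_cstar FF.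
apply: (le_trans (nm_cmul _ _)); rewrite nm_star.
have sa : star (cmul (star a) a) = cmul (star a) a by rewrite starM starK.
apply: (le_trans (ler_wpM2l (nm_ge0 z) (sa_bound _ sa))); rewrite nm_cstar.
have : 0 <= (nm a * nm z) ^+ 2 by rewrite sqr_ge0.
by rewrite !exprMn; lra.
Qed.

End ActionBound.

(** With no unit to serve as [z], [A] acts through [f] on [z = star (f a)]. At [a] itself the
    C*-identity turns the action bound into [nm (f a) ^+ 2 <= 2 * nm a * nm (f a)]. *)
Lemma star_hom_bounded {R : realType} {A B : cstarAlgType R} {f : A -> B} :
  star_hom f -> forall a, nm (f a) <= 2 * nm a.
Proof.
move=> [linf fM fs] a; apply: sqr_le_nm; rewrite ?mulr_ge0 ?nm_ge0//.
rewrite -nm_cstarr -(nm_star (f a)).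
apply: (@action_bound R A B (fun b => cmul (f b) (star (f a))) (star (f a))).
- by move=> k u v; rewrite linf cmul_linearl.
- by move=> u v; rewrite starM fM fs -!cmulA.
- by move=> u; rewrite starM fs -cmulA.
Qed.

(** The set where [f] and [g] agree is a C*-subalgebra, closed because both are bounded. *)
Lemma star_hom_eq {R : realType} {A B : cstarAlgType R} {f g : A -> B}
    {S : set A} :
  star_hom f -> star_hom g -> smallest (@cstar_subalgebra R A) S = setT ->
  (forall a, S a -> f a = g a) -> f = g.
Proof.
move=> hf hg gen fg; apply/funext => a.
have : smallest (@cstar_subalgebra R A) S a by rewrite gen.
move/(_ [set x | f x = g x]); apply; split; last exact: fg.
have [linf fM fs] := hf; have [ling gM gs] := hg.
split.
- apply: nm_closed => v h; apply/subr0_eq/nm_small => e e0.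
  have [|u uS uv] := h (e / 4); first by rewrite divr_gt0 ?ltr0n.
  have := star_hom_bounded hf (v - u); have := star_hom_bounded hg (v - u).
  rewrite (linB linf) (linB ling) uS => h1 h2.
  by have := nm_tri (g u) (f v) (g v); rewrite (nm_dist (g u)); lra.
- split=> [|k u v /= uS vS]; first by rewrite /= (lin0 linf) (lin0 ling).
  by rewrite linf ling uS vS.
- by move=> u v /= uS vS; rewrite fM gM uS vS.
- by move=> u /= uS; rewrite fs gs uS.
Qed.

(** * Ideals and quotients *)

Lemma subspaceB {R : realType} {V : completeNormedModType R[i]} {S : set V} u v :
  linear_subspace S -> S u -> S v -> S (u - v).
Proof. by move=> [_ h] uS vS; rewrite addrC -scaleN1r; apply: h. Qed.

Lemma subspaceZ {R : realType} {V : completeNormedModType R[i]} {S : set V} k u :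
  linear_subspace S -> S u -> S (k *: u).
Proof. by move=> [S0 h] uS; rewrite -[k *: u]addr0; apply: h. Qed.

Lemma subspaceD {R : realType} {V : completeNormedModType R[i]} {S : set V} u v :
  linear_subspace S -> S u -> S v -> S (u + v).
Proof. by move=> [_ h] uS vS; rewrite -[u]scale1r; apply: h. Qed.

Lemma subspaceN {R : realType} {V : completeNormedModType R[i]} {S : set V} u :
  linear_subspace S -> S u -> S (- u).
Proof. by move=> hS uS; rewrite -scaleN1r; apply: subspaceZ. Qed.

Section ErgodicMeans.
Context {R : realType} {A : cstarAlgType R}.

(* With [x = cos] and [1 - g = sin], left multiplication by the unitary
   [w = - (x + i (1 - g))^2] is congruent to the identity modulo the ideal of
   [x], and [C] is a mean of its first powers: [(1 - w) C] tends to [0], while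
   [1 - w] is [x] up to a unitary factor. *)
Lemma ideal_contraction_half (N : set A) (x : A) (e : R) :
    linear_subspace N -> (forall a b, N b -> N (cmul a b)) ->
    (forall a, N (cmul x a)) ->
    star x = x -> nm x <= 2^-1 -> 0 < e ->
  exists C : A -> A, [/\ linear C, forall a b, C (cmul a b) = cmul (C a) b,
    forall a, nm (C a) <= nm a, forall a, N (a - C a) &
    forall a, nm (C (cmul x a)) <= e * nm a].
Proof.
move=> subN Nl Nx sx x1 e0.
have [g [sg gx xg]] := one_minus_sine sx x1.
(* Left multiplications by [x] and [1 - g]; the existentials keep their bodies hidden from
   simplification. *)
have [P defP] : exists P : A -> A, forall c, P c = cmul x c by exists (cmul x).
have [Q defQ] : exists Q : A -> A, forall c, Q c = c - cmul g c.
  by exists (fun c => c - cmul g c).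
have linP : linear P by move=> k u v; rewrite !defP cmul_linearr.
have linQ : linear Q.
  by move=> k u v; rewrite !defQ cmul_linearr opprD addrACA -scalerBr.
have PQ c : P (Q c) = Q (P c) by rewrite !(defP, defQ) cmulBr !cmulA gx.
have PPQQ c : P (P c) + Q (Q c) = c.
  rewrite !(defP, defQ) cmulBr !cmulA -(addrK (cmul g g) (cmul x x)) xg.
  rewrite cmulBl cmulDl.
  exact: double_sub_cancel.
have NQ c : N c -> N (Q c).
  by move=> Nc; rewrite defQ; apply: (subspaceB subN) => //; apply: Nl.
(* Left multiplications by the unitary [x + i (1 - g)] and by its adjoint, written without a
   unit. *)
pose U c := P c + 'i *: Q c; pose U' c := P c - 'i *: Q c.
have linU : linear U.
  move=> k u v; rewrite /U linP linQ scalerDr [k *: (_ + _)]scalerDr.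
  by rewrite !scalerA (mulrC k) addrACA.
have UM a b : U (cmul a b) = cmul (U a) b.
  by rewrite /U !(defP, defQ) cmulDl cmulZl cmulBl !cmulA.
have nmU c : nm (U c) = nm c.
  have [||h1 h2] := @action_unitary R A A (cmul^~ c) c (cmul_linearl c) _ _
      x g sx sg gx xg.
  - by move=> a b; rewrite starM !cmulA.
  - by move=> a; rewrite starM !cmulA.
  - by rewrite /U defP defQ; exact: nm_unitary h1 h2.
have UU' c : U (U' c) = c.
  rewrite /U /U' (linB linP) (linB linQ) (linZ linP) (linZ linQ) PQ.
  rewrite scalerBr scalerA -expr2 sqrCi scaleN1r opprK -addrA addKr.
  exact: PPQQ.
have UaddU' c : U c + U' c = P c + P c by rewrite /U /U' addrACA subrr addr0.
have UN c : N c -> N (U c).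
  move=> Nc; apply: (subspaceD subN); first by rewrite defP.
  by apply: (subspaceZ _ subN); apply: NQ.
pose W c := - U (U c).
have WU c : W (U c) = U (W c) by rewrite /W (linN linU).
have linW : linear W.
  by move=> k u v; rewrite /W !linU opprD scalerN.
have WM a b : W (cmul a b) = cmul (W a) b by rewrite /W !UM cmulNl.
have nmW c : nm (W c) = nm c by rewrite /W nmN !nmU.
(* Since [U'] is inverse to [U], [1 - W = 1 + U^2 = U (U' + U) = 2 U P]. The factor [P] puts this in
   [N], and it is also what the mean has to make small. *)
have W1 c : c - W c = U (P c + P c).
  by rewrite -UaddU' (linD linU) UU' addrC /W opprK.
pose Wn n := iter n W.
have linWn n : linear (Wn n).
  elim: n => [//|n IH] k u v; rewrite /Wn !iterS -/(Wn n) IH.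
  exact: linW.
have WnM n a b : Wn n (cmul a b) = cmul (Wn n a) b.
  by elim: n => [//|n IH]; rewrite /Wn !iterS -/(Wn n) IH WM.
have nmWn n c : nm (Wn n c) = nm c.
  by elim: n => [//|n IH]; rewrite /Wn iterS nmW.
have WnU n c : Wn n (U c) = U (Wn n c).
  by elim: n => [//|n IH]; rewrite /Wn !iterS -/(Wn n) IH WU.
have NWn n c : N (c - Wn n c).
  elim: n => [|n IH]; first by rewrite subrr; case: subN.
  have -> : c - Wn n.+1 c = c - Wn n c + (Wn n c - W (Wn n c)).
    by rewrite addrA subrK.
  apply: (subspaceD subN) => //; rewrite W1; apply: UN.
  by apply: (subspaceD subN); rewrite defP.
have [m me] := invS_small e0.
pose M : R := m.+1%:R^-1.
have M0 : 0 < M by rewrite invr_gt0 ltr0n.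
have MS (v : A) : M%:C *: (v *+ m.+1) = v.
  rewrite -scaler_nat scalerA -(rmorph_nat (real_complex R)) -rmorphM.
  by rewrite mulVf ?pnatr_eq0// rmorph1 scale1r.
pose S n c := \sum_(j < n) Wn j c.
have linS n : linear (S n).
  move=> k u v; rewrite /S scaler_sumr -big_split /=.
  by apply: eq_bigr => j _; rewrite linWn.
have nmS n c : nm (S n c) <= n%:R * nm c.
  elim: n => [|n IH]; first by rewrite /S big_ord0 nm0 mul0r.
  rewrite /S big_ord_recr/= -/(S n c) (le_trans (nmD _ _))//.
  by rewrite nmWn mulrSr mulrDl mul1r lerD2r.
have SW n c : S n (c - W c) = c - Wn n c.
  elim: n => [|n IH]; first by rewrite /S big_ord0 subrr.
  rewrite /S big_ord_recr/= -/(S n _) IH (linB (linWn n)).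
  by rewrite -[Wn n (W c)]iterSr addrA subrK.
pose C c := M%:C *: S m.+1 c.
have linC : linear C.
  by move=> k u v; rewrite /C linS scalerDr !scalerA mulrC.
have SU n c : S n (U c) = U (S n c).
  elim: n => [|n IH]; first by rewrite /S !big_ord0 (lin0 linU).
  by rewrite /S !big_ord_recr/= -!/(S n _) IH WnU (linD linU).
exists C; split=> //.
- move=> a b; rewrite /C cmulZl; congr (_ *: _).
  elim: (m.+1) => [|n IH]; first by rewrite /S !big_ord0 cmul0l.
  by rewrite /S !big_ord_recr/= -!/(S n _) IH WnM cmulDl.
- move=> a; rewrite /C nmZr ?(ltW M0)//.
  apply: (le_trans (ler_wpM2l (ltW M0) (nmS m.+1 a))).
  by rewrite mulrA mulVf ?mul1r// pnatr_eq0.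
- move=> a; rewrite -{1}(MS a) /C -scalerBr; apply: (subspaceZ _ subN).
  elim: (m.+1) => [|n IH].
    by rewrite /S big_ord0 subr0; case: subN.
  rewrite mulrSr /S big_ord_recr/= -/(S n _) opprD addrACA.
  exact: (subspaceD subN).
- move=> a.
  (* [U] is isometric and commutes with the mean, so the left side is the norm of [C (a - W a)],
     where the sum telescopes to [a - Wn m.+1 a]. *)
  have : nm (C (P a + P a)) <= M * (2 * nm a).
    rewrite -nmU /C (linZ linU) -SU -W1 SW nmZr ?(ltW M0)//.
    rewrite ler_wpM2l ?(ltW M0)// (le_trans (nmB _ _))// nmWn.
    by rewrite mulr2n mulrDl mul1r.
  rewrite -mulr2n -scaler_nat -(rmorph_nat (real_complex R)) (linZ linC) -defP.
  rewrite nmZr ?ler0n// => h.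
  have : nm (C (P a)) <= M * nm a by lra.
  by move/le_trans; apply; rewrite ler_wpM2r ?nm_ge0// ltW.
Qed.

(** [C] behaves as left multiplication by a multiplier. When [C] is a contraction, the case [a = b]
    bounds [nm (C a) ^+ 2] by [nm (C (cmul a (star a)))]. *)
Lemma contraction_cstar (C : A -> A) a b :
    (forall a b, C (cmul a b) = cmul (C a) b) ->
  cmul (C a) (star (C b)) = C (star (C (cmul b (star a)))).
Proof. by move=> CM; rewrite (CM b) starM starK CM. Qed.

(** [1 - C] plays the part of an approximate unit of [N] at [x]. The previous construction makes [C]
    small on multiples of [x] only; it is used on [cmul x x], from which the C*-identity returns to
    [x]. *)
Lemma ideal_contraction (N : set A) (x : A) (e : R) :
    cstar_ideal N -> N x -> star x = x -> 0 < e ->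
  exists C : A -> A, [/\ linear C, forall a b, C (cmul a b) = cmul (C a) b,
    forall a, nm (C a) <= nm a, forall a, N (a - C a) & nm (C x) <= e].
Proof.
move=> [_ subN Nl Nr] Nx sx e0.
pose t := 2^-1 / (nm x + 1).
have x1 : 0 < nm x + 1 by rewrite ltr_wpDl ?nm_ge0.
have t0 : 0 < t by rewrite divr_gt0 ?invr_gt0 ?ltr0n.
pose y := t%:C *: x.
have yx : x = (t^-1)%:C *: y.
  by rewrite scalerA -rmorphM mulVf ?gt_eqF// rmorph1 scale1r.
have Ny : N y by apply: (subspaceZ _ subN).
have sy : star y = y.
  by rewrite /y starZ sx; congr (_ *: _); exact: conjc_real.
have y1 : nm y <= 2^-1.
  rewrite nmZr ?(ltW t0)// /t -mulrA ler_piMr ?invr_ge0 ?ler0n// mulrC.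
  by rewrite ler_pdivrMr// mul1r lerDl.
(* Chosen so that [nm (C (cmul x x)) <= t^-1 * d * nm x <= e ^+ 2]; the [+ 1] avoids a division by 0
   when [x = 0]. *)
pose d := e ^+ 2 * t / (nm x + 1).
have d0 : 0 < d by rewrite /d divr_gt0// mulr_gt0// exprn_gt0.
have [C [linC CM nmC NC Cy]] :=
  ideal_contraction_half subN Nl (fun a => Nr _ a Ny) sy y1 d0.
exists C; split=> //.
rewrite -ler_sqr ?nnegrE ?nm_ge0 ?(ltW e0)//.
rewrite -nm_cstarr contraction_cstar// (le_trans (nmC _))// nm_star sx.
rewrite {1}yx cmulZl (linZ linC) nmZr ?invr_ge0 ?(ltW t0)//.
rewrite mulrC ler_pdivrMr// (le_trans (Cy x))// /d.
rewrite mulrAC ler_pdivrMr// ler_wpM2l ?lerDl//.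
by rewrite mulr_ge0 ?sqr_ge0 ?(ltW t0).
Qed.

End ErgodicMeans.

(** * The quotient C*-algebra *)

Lemma le_of_lt_le {R : realType} (x y : R) : (forall r, y < r -> x <= r) -> x <= y.
Proof.
move=> h; rewrite leNgt; apply/negP => yx.
by have := h ((x + y) / 2); lra.
Qed.

Lemma le_mul_of_lt {R : realType} (p q z : R) : 0 <= p -> 0 <= q ->
  (forall r s, p < r -> q < s -> z <= r * s) -> z <= p * q.
Proof.
move=> p0 q0 h.
have h1 s : q < s -> z <= p * s.
  move=> qs; have s0 : 0 < s by apply: le_lt_trans qs.
  rewrite -ler_pdivrMr//; apply: le_of_lt_le => r pr.
  by rewrite ler_pdivrMr// h.
have [p00|p00] := eqVneq p 0.
  by have := h1 (q + 1); rewrite p00 !mul0r; apply; rewrite ltrDl.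
have {}p00 : 0 < p by rewrite lt_def p00.
rewrite mulrC -ler_pdivrMr//; apply: le_of_lt_le => s qs.
by rewrite ler_pdivrMr// mulrC h1.
Qed.

(** The reverse inequality is the given one for [k^-1] at [k *: x]. It serves both the quotient norm
    and the operator norm. *)
Lemma homogeneous_of_le {R : realType} {V : lmodType R[i]} (n : V -> R) :
    (forall x, 0 <= n x) -> (forall k x, n (k *: x) <= complex.Re `|k| * n x) ->
  forall k x, (n (k *: x))%:C = `|k| * (n x)%:C.
Proof.
move=> n0 nZ k x; suff -> : n (k *: x) = complex.Re `|k| * n x.
  by rewrite -[X in _ = X * _](RRe_real (ger0_real (normr_ge0 k))) -rmorphM.
apply/eqP; rewrite eq_le nZ andTb.
have [->|k0] := eqVneq k 0.
  by rewrite normr0 mul0r.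
have k1 : 0 < complex.Re `|k|.
  by rewrite -ltcR RRe_real ?normr_gt0// ger0_real.
have := nZ k^-1 (k *: x).
rewrite scalerA mulVf// scale1r.
have -> : complex.Re `|k^-1| = (complex.Re `|k|)^-1.
  apply: (@complexI R).
  by rewrite fmorphV !RRe_real ?normfV ?rpredV ?ger0_real.
by rewrite mulrC ler_pdivlMr// mulrC.
Qed.

Section Quotient.
Context {R : realType} {A : cstarAlgType R} {N : set A}.
Hypotheses (idN : cstar_ideal N) (starNN : forall a, N a -> N (star a)).
Implicit Types (a b c : A).

Let subN : linear_subspace N. Proof. by case: idN. Qed.

Definition quo_rel : rel A := fun a b => `[< N (a - b) >].

Lemma quo_rel_equiv : equiv_class_of quo_rel.
Proof.
split=> [a|a b|b a c].
- by apply/asboolP; rewrite subrr; case: subN.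
- by apply/asboolP/asboolP => /(subspaceN subN); rewrite opprB.
- move=> /asboolP ab /asboolP bc; apply/asboolP.
  by rewrite -[a](subrK b) -addrA; apply: (subspaceD subN).
Qed.

Definition quo_equiv := EquivRelPack quo_rel_equiv.
Definition quo := {eq_quot quo_equiv}.
HB.instance Definition _ := Choice.on quo.

Definition qpi a : quo := \pi_quo a.
Definition qrep (x : quo) : A := repr x.

Lemma qrepK x : qpi (qrep x) = x.
Proof. exact: reprK. Qed.

Lemma qpiP a b : qpi a = qpi b <-> N (a - b).
Proof.
by split=> [/eqmodP/asboolP//|h]; apply/eqmodP/asboolP.
Qed.

Lemma qrep_pi a : N (qrep (qpi a) - a).
Proof. by apply/qpiP; rewrite qrepK. Qed.

Definition qadd (x y : quo) : quo := qpi (qrep x + qrep y).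
Definition qscale (k : R[i]) (x : quo) : quo := qpi (k *: qrep x).
Definition qopp (x : quo) : quo := qpi (- qrep x).
Definition qmul (x y : quo) : quo := qpi (cmul (qrep x) (qrep y)).
Definition qstar (x : quo) : quo := qpi (star (qrep x)).

Lemma qpiD a b : qadd (qpi a) (qpi b) = qpi (a + b).
Proof. by apply/qpiP; rewrite opprD addrACA; apply: (subspaceD subN); exact: qrep_pi. Qed.

Lemma qpiZ k a : qscale k (qpi a) = qpi (k *: a).
Proof. by apply/qpiP; rewrite -scalerBr; apply: (subspaceZ _ subN); exact: qrep_pi. Qed.

Lemma qpiN a : qopp (qpi a) = qpi (- a).
Proof.
by apply/qpiP; rewrite opprK addrC -opprB; apply: (subspaceN subN); exact: qrep_pi.
Qed.

Lemma qpiM a b : qmul (qpi a) (qpi b) = qpi (cmul a b).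
Proof.
have [_ _ Nl Nr] := idN; apply/qpiP.
rewrite -(subrK (cmul (qrep (qpi a)) b) (cmul _ (qrep (qpi b)))) -addrA.
rewrite -cmulBr -cmulBl; apply: (subspaceD subN).
  by apply: Nl; exact: qrep_pi.
by apply: Nr; exact: qrep_pi.
Qed.

Lemma qpiS a : qstar (qpi a) = qpi (star a).
Proof. by apply/qpiP; rewrite -starB; apply: starNN; exact: qrep_pi. Qed.

Lemma qind (P : quo -> Prop) : (forall a, P (qpi a)) -> forall x, P x.
Proof. by move=> h x; rewrite -[x]qrepK. Qed.

Let qaddA : associative qadd.
Proof. by elim/qind=> a; elim/qind=> b; elim/qind=> c; rewrite !qpiD addrA. Qed.
Let qaddC : commutative qadd.
Proof. by elim/qind=> a; elim/qind=> b; rewrite !qpiD addrC. Qed.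
Let qadd0 : left_id (qpi 0) qadd.
Proof. by elim/qind=> a; rewrite qpiD add0r. Qed.
Let qaddN : left_inverse (qpi 0) qopp qadd.
Proof. by elim/qind=> a; rewrite qpiN qpiD addNr. Qed.

HB.instance Definition _ := GRing.isZmodule.Build quo qaddA qaddC qadd0 qaddN.

Let qaddE (x y : quo) : x + y = qadd x y.
Proof. by []. Qed.

Let qscaleA k l x : qscale k (qscale l x) = qscale (k * l) x.
Proof. by elim/qind: x => a; rewrite !qpiZ scalerA. Qed.
Let qscale1 : left_id 1 qscale.
Proof. by elim/qind=> a; rewrite qpiZ scale1r. Qed.
Let qscaleDr : right_distributive qscale +%R.
Proof.
by move=> k; elim/qind=> a; elim/qind=> b; rewrite !(qaddE, qpiZ, qpiD) scalerDr.
Qed.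
Let qscaleDl x : {morph qscale^~ x : k l / k + l}.
Proof.
by elim/qind: x => a k l; rewrite /= !(qaddE, qpiZ, qpiD) scalerDl.
Qed.

HB.instance Definition _ :=
  GRing.Zmodule_isLmodule.Build R[i] quo qscaleA qscale1 qscaleDr qscaleDl.

Lemma qpi_linear : linear qpi.
Proof. by move=> k a b; rewrite -qpiD -qpiZ. Qed.

Lemma qpi_eq0 a : qpi a = 0 <-> N a.
Proof. by rewrite -[X in N X]subr0; exact: qpiP. Qed.

Definition qnm (x : quo) : R := inf [set nm a | a in [set a | qpi a = x]].

Lemma qnm_has_inf x : has_inf [set nm a | a in [set a | qpi a = x]].
Proof.
split; first by exists (nm (qrep x)), (qrep x) => //; exact: qrepK.
by exists 0 => _ [a _ <-]; exact: nm_ge0.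
Qed.

Lemma qnm_le a : qnm (qpi a) <= nm a.
Proof. by apply: ge_inf; [case: (qnm_has_inf (qpi a)) | exists a]. Qed.

Lemma qnm_lt x r : qnm x < r -> exists2 a, qpi a = x & nm a < r.
Proof.
rewrite -subr_gt0 => /inf_adherent/(_ (qnm_has_inf x))[_ [a ax <-]].
by rewrite addrC subrK => ar; exists a.
Qed.

Lemma qnm_ge0 x : 0 <= qnm x.
Proof.
rewrite leNgt; apply/negP => /qnm_lt[a _].
by rewrite ltNge nm_ge0.
Qed.

Let qnormD (x y : quo) : (qnm (x + y))%:C <= (qnm x)%:C + (qnm y)%:C.
Proof.
rewrite -rmorphD lecR; apply: le_of_lt_le => r xyr.
pose d := (r - qnm x - qnm y) / 2.
have [|a ax ad] := @qnm_lt x (qnm x + d); first by rewrite /d; lra.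
have [|b bx bd] := @qnm_lt y (qnm y + d); first by rewrite /d; lra.
have := qnm_le (a + b); rewrite (linD qpi_linear) ax bx.
by have := nmD a b; rewrite /d in ad bd *; lra.
Qed.

Let qnormZ_le k x : qnm (k *: x) <= complex.Re `|k| * qnm x.
Proof.
have k0 : 0 <= complex.Re `|k| by rewrite -ler0c RRe_real// ger0_real.
have [k00|k00] := eqVneq k 0.
  rewrite k00 normr0 mul0r scale0r.
  by have := qnm_le 0; rewrite nm0 (lin0 qpi_linear).
have {}k0 : 0 < complex.Re `|k|.
  by rewrite -ltcR RRe_real ?normr_gt0// ger0_real.
rewrite mulrC -ler_pdivrMr//; apply: le_of_lt_le => r /qnm_lt[a <- ar].
rewrite ler_pdivrMr// -(linZ qpi_linear) (le_trans (qnm_le _))//.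
by rewrite nmZ mulrC ler_pM2r// ltW.
Qed.

Let qnormZ k x : (qnm (k *: x))%:C = `|k| * (qnm x)%:C.
Proof. exact: homogeneous_of_le qnm_ge0 qnormZ_le k x. Qed.

Let qnorm0 x : (qnm x)%:C = 0 -> x = 0.
Proof.
move=> x0; have {}x0 : qnm x = 0 by apply: (@complexI R).
have [cN _ _ _] := idN.
rewrite -[x]qrepK; apply/qpi_eq0; apply: (closed_nm cN) => e e0.
have [|a ax ae] := @qnm_lt x e; first by rewrite x0.
exists (qrep x - a); last by rewrite opprB addrC subrK.
by apply/qpiP; rewrite qrepK.
Qed.

HB.instance Definition _ :=
  @Lmodule_isNormed.Build R[i] quo (fun x => (qnm x)%:C) qnormD qnormZ qnorm0.

Lemma nm_quo (x : quo) : nm x = qnm x.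
Proof. by []. Qed.

(** The infimum need not be attained, so each step is lifted with twice its allowed norm. The lifted
    partial sums [a] are halved to make them fast, and their limit is doubled back. *)
Let quo_complete (F : set_system quo) : ProperFilter F -> cauchy F -> cvg F.
Proof.
apply: fast_cauchy_cvg_complete => u fu.
have P n : {d : A | qpi d = u n.+1 - u n & nm d <= 2 * 2^-1 ^+ n}.
  apply: cid2; have [|d dE dn] := @qnm_lt (u n.+1 - u n) (2 * 2^-1 ^+ n).
    have := fu n; rewrite nm_quo; have := @half_exp_gt0 R n; lra.
  by exists d => //; exact: ltW.
pose a := fix a n := if n is m.+1 then a m + s2val (P m) else qrep (u 0%N).
have aE n : qpi (a n) = u n.
  elim: n => [|n IH]; first exact: qrepK.
  by rewrite /= (linD qpi_linear) IH (s2valP (P n)) addrC subrK.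
have nm2 b : nm ((2^-1 : R)%:C *: b) = 2^-1 * nm b by rewrite nmZr// invr_ge0.
have [|l lP] := @fast_cauchy_cvg R A (fun n => (2^-1 : R)%:C *: a n).
  move=> n; rewrite -scalerBr /= addrAC subrr add0r nm2.
  by have := s2valP' (P n); lra.
exists (qpi ((2 : R)%:C *: l)) => n; rewrite -(aE n) -(linB qpi_linear) nm_quo.
apply: (le_trans (qnm_le _)).
have -> : (2 : R)%:C *: l - a n = (2 : R)%:C *: (l - (2^-1 : R)%:C *: a n).
  by rewrite scalerBr scalerA -rmorphM divff ?pnatr_eq0// scale1r.
by rewrite nmZr ?ler0n//; have := lP n; lra.
Qed.

HB.instance Definition _ := Uniform_isComplete.Build quo quo_complete.

Let qmulA : associative qmul.
Proof. by elim/qind=> a; elim/qind=> b; elim/qind=> c; rewrite !qpiM cmulA. Qed.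
Let qmul_linearl y : linear (qmul^~ y).
Proof.
move=> k; elim/qind: y => c; elim/qind=> a; elim/qind=> b.
by rewrite -(qpi_linear k) !qpiM -(qpi_linear k) cmul_linearl.
Qed.
Let qmul_linearr x : linear (qmul x).
Proof.
move=> k; elim/qind: x => c; elim/qind=> a; elim/qind=> b.
by rewrite -(qpi_linear k) !qpiM -(qpi_linear k) cmul_linearr.
Qed.
Let qnm_mul x y : qnm (qmul x y) <= qnm x * qnm y.
Proof.
apply: le_mul_of_lt; rewrite ?qnm_ge0// => r s /qnm_lt[a <- ar] /qnm_lt[b <- bs].
rewrite qpiM (le_trans (qnm_le _))// (le_trans (nm_cmul _ _))//.
by rewrite ler_pM ?nm_ge0// ltW.
Qed.
Let qmul_norm (x y : quo) : `|qmul x y| <= `|x| * `|y|.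
Proof. by rewrite !nmE -rmorphM lecR !nm_quo qnm_mul. Qed.
Let qstarK : involutive qstar.
Proof. by elim/qind=> a; rewrite !qpiS starK. Qed.
Let qstarM x y : qstar (qmul x y) = qmul (qstar y) (qstar x).
Proof.
by elim/qind: x => a; elim/qind: y => b; rewrite !(qpiM, qpiS) starM.
Qed.
Let qstar_antilinear (k : R[i]) (x y : quo) :
  qstar (k *: x + y) = Num.conj k *: qstar x + qstar y.
Proof.
elim/qind: x => a; elim/qind: y => b.
by rewrite -qpi_linear !qpiS -qpi_linear star_antilinear.
Qed.
Let qnm_star_le x : qnm (qstar x) <= qnm x.
Proof.
apply: le_of_lt_le => r /qnm_lt[a <- ar].
by rewrite qpiS (le_trans (qnm_le _))// nm_star ltW.
Qed.
Let qnm_star x : qnm (qstar x) = qnm x.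
Proof.
by apply/eqP; rewrite eq_le qnm_star_le/= -{1}[x]qstarK qnm_star_le.
Qed.
(** Let [b] represent the product with nearly minimal norm, and let [h] be the self-adjoint part of
    [cmul a (star a) - b], an element of [N]. A contraction [C] that is the identity modulo [N] and
    nearly kills [h] gives [qnm (qpi a) ^+ 2 <= nm (C a) ^+ 2 <= nm (C (cmul a (star a)))], which is
    at most [nm (cmul a (star a) - h) + nm (C h)]. *)
Let qnm_cstarr x : qnm x ^+ 2 <= qnm (qmul x (qstar x)).
Proof.
apply: le_of_lt_le => r.
elim/qind: x => a; rewrite qpiS qpiM => /qnm_lt[b /qpiP Nb br].
apply: le_of_lt_le => s rs.
pose t : R := 2^-1.
have t2 (v : A) : t%:C *: v + t%:C *: v = v.
  rewrite -scalerDl -rmorphD/= -mulr2n -[_ *+ 2]mulr_natl divff.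
    by rewrite rmorph1 scale1r.
  by rewrite pnatr_eq0.
pose n := cmul a (star a) - b; pose h := t%:C *: (n + star n).
have Nn : N n by rewrite /n -opprB; exact: (subspaceN subN).
have Nh : N h.
  by apply: (subspaceZ _ subN); apply: (subspaceD subN) => //; apply: starNN.
have sh : star h = h.
  rewrite /h starZ starD starK addrC; congr (_ *: _).
  exact: (conjc_real t).
(* Symmetrizing costs nothing: the difference is the self-adjoint part of [b]. *)
have ah : nm (cmul a (star a) - h) < r.
  have -> : cmul a (star a) - h = t%:C *: (b + star b).
    have saa : star (cmul a (star a)) = cmul a (star a) by rewrite starM starK.
    rewrite /h -{1}[cmul _ _]t2 -scalerDr -scalerBr; congr (_ *: _).
    by rewrite opprD addrACA /n starB saa !subKr.
  rewrite nmZr ?invr_ge0 ?ler0n//.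
  by have := nmD b (star b); rewrite nm_star /t; lra.
have [|C [linC CM nmC NC Ch]] := @ideal_contraction R A N h (s - r) idN Nh sh.
  by rewrite subr_gt0.
have : qnm (qpi a) <= nm (C a).
  by rewrite -(_ : qpi (C a) = qpi a) ?qnm_le//; apply/esym/qpiP.
rewrite -ler_sqr ?nnegrE ?nm_ge0 ?qnm_ge0// => /le_trans; apply.
rewrite -nm_cstarr contraction_cstar// (le_trans (nmC _))// nm_star.
rewrite -[cmul _ _](subrK h) (linD linC) (le_trans (nmD _ _))//.
by have := nmC (cmul a (star a) - h); lra.
Qed.
Let qcstar_norm (x : quo) : `|qmul (qstar x) x| = `|x| ^+ 2.
Proof.
rewrite !nmE -rmorphXn !nm_quo; suff -> : qnm (qmul (qstar x) x) = qnm x ^+ 2 by [].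
have := qnm_cstarr (qstar x); rewrite qstarK qnm_star => h.
by apply/eqP; rewrite eq_le h andbT (le_trans (qnm_mul _ _))// qnm_star.
Qed.

HB.instance Definition _ := isCstarAlgebra.Build R quo qmulA qmul_linearl
  qmul_linearr qmul_norm qstarK qstarM qstar_antilinear qcstar_norm.

Lemma qpi_quotient : cstar_quotient N (qpi : A -> quo).
Proof.
split=> //.
  split; first exact: qpi_linear.
    by move=> a b; rewrite -qpiM.
  by move=> a; rewrite -qpiS.
split.
- exact: qpi_linear.
- by apply/seteqP; split=> // x _; exists (qrep x) => //; exact: qrepK.
- by apply/seteqP; split=> a /qpi_eq0.
- move=> a n Nn; rewrite !nmE lecR nm_quo.
  have -> : qpi a = qpi (a - n) by apply/qpiP; rewrite opprB addrC subrK.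
  exact: qnm_le.
- move=> a e e0.
  have er : e = (complex.Re e)%:C by rewrite RRe_real// gtr0_real.
  have [|b /qpiP ba bl] := @qnm_lt (qpi a) (qnm (qpi a) + complex.Re e).
    by rewrite ltrDl -ltcR -er.
  exists (a - b); first by rewrite -opprB; exact: (subspaceN subN).
  by rewrite opprB addrC subrK er !nmE -rmorphD ltcR.
Qed.

End Quotient.

Lemma cstar_quotient_exists {R : realType} {A : cstarAlgType R} (N : set A) :
  cstar_ideal N -> (forall a, N a -> N (star a)) ->
  exists (D : cstarAlgType R) (p : A -> D), cstar_quotient N p.
Proof. by move=> idN sN; eexists; eexists; exact: (qpi_quotient idN sN). Qed.

(** * The multiplier algebra *)

Lemma star_cmul_inj {R : realType} {A : cstarAlgType R} (a b : A) :
  (forall y, cmul (star a) y = cmul (star b) y) -> a = b.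
Proof.
move=> h; apply/subr0_eq/cstar_eq0.
by rewrite starB cmulBl h subrr.
Qed.

Section Multipliers.
Context {R : realType} {A : cstarAlgType R}.
Implicit Types (x y : A) (f g : A -> A) (k : R[i]).

(** The algebra is viewed as a right Hilbert module over itself, with inner product
    [cmul (star x) y]; multipliers are its adjointable operators. *)
Definition is_adjoint f g := forall x y, cmul (star (f x)) y = cmul (star x) (g y).

(** The clause [0 <= K] keeps the set of bounds bounded below, even over the zero algebra, so that
    its infimum is the operator norm. *)
Definition op_bound f (K : R) := 0 <= K /\ forall x, nm (f x) <= K * nm x.

Definition adjointable f := (exists g, is_adjoint f g) /\ (exists K, op_bound f K).

Lemma is_adjoint_sym f g : is_adjoint f g -> is_adjoint g f.
Proof.
move=> fg x y; apply: (can_inj (@starK R A)).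
by rewrite !starM !starK fg.
Qed.

Lemma is_adjoint_unique f g h : is_adjoint f g -> is_adjoint f h -> g =1 h.
Proof.
move=> fg fh y; apply: star_cmul_inj => x.
by rewrite (is_adjoint_sym fg) (is_adjoint_sym fh).
Qed.

Lemma is_adjoint_linear f g : is_adjoint f g -> linear f.
Proof.
move=> fg k u v; apply: star_cmul_inj => y.
by rewrite fg !starD !starZ !cmulDl !cmulZl !fg.
Qed.

Lemma op_bound_adjoint f g K : is_adjoint f g -> op_bound f K -> op_bound g K.
Proof.
move=> fg [K0 fK]; split=> // y; apply: sqr_le_nm; rewrite ?mulr_ge0 ?nm_ge0//.
rewrite -nm_cstar (is_adjoint_sym fg) (le_trans (nm_cmul _ _))// nm_star.
by rewrite (mulrC K) -mulrA ler_wpM2l ?nm_ge0.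
Qed.

Record mult := Mult { mfun :> A -> A; mult_adjointable : adjointable mfun }.

Implicit Types (m p : mult).

HB.instance Definition _ := gen_eqMixin mult.
HB.instance Definition _ := gen_choiceMixin mult.

Lemma mult_ext (m n : mult) : m =1 n -> m = n.
Proof.
case: m n => [f pf] [g pg] /= /funext fg; subst g.
by rewrite (Prop_irrelevance pf pg).
Qed.

Definition madj (m : mult) : A -> A := projT1 (cid (mult_adjointable m).1).

Lemma madjP m : is_adjoint m (madj m).
Proof. exact: projT2 (cid (mult_adjointable m).1). Qed.

Lemma mult_linear (m : mult) : linear m.
Proof. exact: is_adjoint_linear (madjP m). Qed.

Lemma mult_bounded (m : mult) : exists K, op_bound m K.
Proof. by case: m => f []. Qed.

Lemma adjointable0 : adjointable (fun=> 0).
Proof.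
split; first by exists (fun=> 0) => x y; rewrite star0 cmul0l cmul0r.
by exists 0; split=> // x; rewrite nm0 mul0r.
Qed.

Lemma is_adjoint_comb k f f' g g' : is_adjoint f f' -> is_adjoint g g' ->
  is_adjoint (fun x => k *: f x + g x) (fun x => Num.conj k *: f' x + g' x).
Proof.
move=> ff gg x y.
by rewrite starD starZ cmulDl cmulZl cmulDr cmulZr ff gg.
Qed.

Lemma adjointable_comb k (m n : mult) : adjointable (fun x => k *: m x + n x).
Proof.
split; first by eexists; apply: is_adjoint_comb; exact: madjP.
have [K [K0 mK]] := mult_bounded m; have [L [L0 nL]] := mult_bounded n.
have k0 : 0 <= complex.Re `|k| by rewrite -ler0c RRe_real// ger0_real.
exists (complex.Re `|k| * K + L); split; first by rewrite addr_ge0 ?mulr_ge0.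
move=> x; rewrite (le_trans (nmD _ _))// nmZ mulrDl lerD// -mulrA.
by rewrite ler_wpM2l.
Qed.

(** Sum, opposite and scaling are all instances of this, so adjointability is checked once for the
    three. *)
Definition mcomb k m (n : mult) := Mult (adjointable_comb k m n).
Definition mzero := Mult adjointable0.
Definition madd m (n : mult) := mcomb 1 m n.
Definition mopp m := mcomb (-1) m mzero.
Definition mscale k m := mcomb k m mzero.

Lemma maddE m (n : mult) x : madd m n x = m x + n x.
Proof. by rewrite /= scale1r. Qed.
Lemma moppE m x : mopp m x = - m x.
Proof. by rewrite /= scaleN1r addr0. Qed.
Lemma mscaleE k m x : mscale k m x = k *: m x.
Proof. by rewrite /= addr0. Qed.

Let maddA : associative madd.
Proof. by move=> m n p; apply: mult_ext => x; rewrite !maddE addrA. Qed.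
Let maddC : commutative madd.
Proof. by move=> m n; apply: mult_ext => x; rewrite !maddE addrC. Qed.
Let madd0 : left_id mzero madd.
Proof. by move=> m; apply: mult_ext => x; rewrite !maddE add0r. Qed.
Let maddN : left_inverse mzero mopp madd.
Proof. by move=> m; apply: mult_ext => x; rewrite !maddE moppE addNr. Qed.

HB.instance Definition _ := GRing.isZmodule.Build mult maddA maddC madd0 maddN.

Let mscaleA k l m : mscale k (mscale l m) = mscale (k * l) m.
Proof. by apply: mult_ext => x; rewrite !mscaleE scalerA. Qed.
Let mscale1 : left_id 1 mscale.
Proof. by move=> m; apply: mult_ext => x; rewrite !mscaleE scale1r. Qed.
Let mscaleDr : right_distributive mscale +%R.
Proof.
by move=> k m n; apply: mult_ext => x; rewrite !(mscaleE, maddE) scalerDr.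
Qed.
Let mscaleDl m : {morph mscale^~ m : k l / k + l}.
Proof.
by move=> k l; apply: mult_ext => x; rewrite !(mscaleE, maddE) scalerDl.
Qed.

HB.instance Definition _ :=
  GRing.Zmodule_isLmodule.Build R[i] mult mscaleA mscale1 mscaleDr mscaleDl.

Lemma mfunD (m n : mult) x : (m + n) x = m x + n x.
Proof. exact: maddE. Qed.
Lemma mfunN (m : mult) x : (- m) x = - m x.
Proof. exact: moppE. Qed.
Lemma mfunB (m n : mult) x : (m - n) x = m x - n x.
Proof. by rewrite mfunD mfunN. Qed.
Lemma mfunZ k (m : mult) x : (k *: m) x = k *: m x.
Proof. exact: mscaleE. Qed.

Definition opnm (m : mult) : R := inf [set K | op_bound m K].

Let opnm_lb (m : mult) : has_lbound [set K | op_bound m K].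
Proof. by exists 0 => K []. Qed.

Lemma opnm_ge0 m : 0 <= opnm m.
Proof. by apply: lb_le_inf; [exact: mult_bounded | move=> K []]. Qed.

Lemma opnm_min m K : op_bound m K -> opnm m <= K.
Proof. by move=> mK; apply: ge_inf. Qed.

Lemma opnmP m x : nm (m x) <= opnm m * nm x.
Proof.
have [x0|x0] := eqVneq (nm x) 0.
  by have [K [_ /(_ x)]] := mult_bounded m; rewrite x0 !mulr0.
have {}x0 : 0 < nm x by rewrite lt_def x0 nm_ge0.
rewrite -ler_pdivrMr//; apply: le_of_lt_le => r.
rewrite -subr_gt0 => /(@inf_adherent R [set K | op_bound m K]).
move=> /(_ (conj (mult_bounded m) (opnm_lb m)))[K [K0 mK]].
rewrite addrC subrK => /ltW Kr; rewrite (le_trans _ Kr)//.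
by rewrite ler_pdivrMr.
Qed.

Lemma opnm_bound m : op_bound m (opnm m).
Proof. by split; [exact: opnm_ge0 | exact: opnmP]. Qed.

Let mnormD m (n : mult) : (opnm (m + n))%:C <= (opnm m)%:C + (opnm n)%:C.
Proof.
rewrite -rmorphD lecR; apply: opnm_min; split; first by rewrite addr_ge0 ?opnm_ge0.
by move=> x; rewrite mfunD (le_trans (nmD _ _))// mulrDl lerD// opnmP.
Qed.

Let mnormZ_le k (m : mult) : opnm (k *: m) <= complex.Re `|k| * opnm m.
Proof.
have k0 : 0 <= complex.Re `|k| by rewrite -ler0c RRe_real// ger0_real.
apply: opnm_min; split; first by rewrite mulr_ge0 ?opnm_ge0.
by move=> x; rewrite mfunZ nmZ -mulrA ler_wpM2l// opnmP.
Qed.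

Let mnormZ k m : (opnm (k *: m))%:C = `|k| * (opnm m)%:C.
Proof. exact: homogeneous_of_le opnm_ge0 mnormZ_le k m. Qed.

Let mnorm0 m : (opnm m)%:C = 0 -> m = 0.
Proof.
move=> m0; have {}m0 : opnm m = 0 by apply: (@complexI R).
apply: mult_ext => x; apply: nm_le0.
by rewrite (le_trans (opnmP _ _))// m0 mul0r.
Qed.

HB.instance Definition _ :=
  @Lmodule_isNormed.Build R[i] mult (fun m => (opnm m)%:C) mnormD mnormZ mnorm0.

Lemma nm_mult (m : mult) : nm m = opnm m.
Proof. by []. Qed.

Lemma adjointable_adj m : adjointable (madj m).
Proof.
split; first by exists m; exact/is_adjoint_sym/madjP.
by exists (opnm m); apply: op_bound_adjoint (madjP m) (opnm_bound m).
Qed.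

Lemma adjointable_comp (m n : mult) : adjointable (m \o n).
Proof.
split.
  by exists (madj n \o madj m) => x y /=; rewrite madjP madjP.
exists (opnm m * opnm n); split; first by rewrite mulr_ge0 ?opnm_ge0.
move=> x /=; rewrite (le_trans (opnmP _ _))// -mulrA ler_wpM2l ?opnm_ge0//.
exact: opnmP.
Qed.

Definition mstar m := Mult (adjointable_adj m).
Definition mmul m (n : mult) := Mult (adjointable_comp m n).

Lemma mstarP m : is_adjoint m (mstar m).
Proof. exact: madjP. Qed.

Lemma mstar_eq m (n : mult) : is_adjoint m n -> mstar m = n.
Proof. by move=> mn; apply: mult_ext; exact: is_adjoint_unique (mstarP m) mn. Qed.

Lemma mmulE m (n : mult) x : mmul m n x = m (n x).
Proof. by []. Qed.

Let mmulA : associative mmul.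
Proof. by move=> m n p; apply: mult_ext. Qed.
Let mmul_linearl n : linear (mmul^~ n).
Proof. by move=> k m p; apply: mult_ext => x; rewrite !(mmulE, mfunD, mfunZ). Qed.
Let mmul_linearr m : linear (mmul m).
Proof.
move=> k n p; apply: mult_ext => x.
by rewrite !(mmulE, mfunD, mfunZ) mult_linear.
Qed.
Let opnm_mul m (n : mult) : opnm (mmul m n) <= opnm m * opnm n.
Proof.
apply: opnm_min; split; first by rewrite mulr_ge0 ?opnm_ge0.
move=> x /=; rewrite (le_trans (opnmP _ _))// -mulrA ler_wpM2l ?opnm_ge0//.
exact: opnmP.
Qed.
Let mmul_norm (m n : mult) : `|mmul m n| <= `|m| * `|n|.
Proof. by rewrite !nmE -rmorphM lecR !nm_mult opnm_mul. Qed.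
Let mstarK : involutive mstar.
Proof. by move=> m; apply: mstar_eq; exact/is_adjoint_sym/mstarP. Qed.
Let mstarM m (n : mult) : mstar (mmul m n) = mmul (mstar n) (mstar m).
Proof. by apply: mstar_eq => x y /=; rewrite !madjP. Qed.
Let mstar_antilinear k (m n : mult) :
  mstar (k *: m + n) = Num.conj k *: mstar m + mstar n.
Proof.
apply: mstar_eq => x y; rewrite !(mfunD, mfunZ).
exact: (is_adjoint_comb k (mstarP m) (mstarP n)).
Qed.
Let opnm_star_le m : opnm (mstar m) <= opnm m.
Proof. exact/opnm_min/(op_bound_adjoint (madjP m) (opnm_bound m)). Qed.
Lemma opnm_star m : opnm (mstar m) = opnm m.
Proof. by apply/eqP; rewrite eq_le opnm_star_le -{1}[m]mstarK opnm_star_le. Qed.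
(** [nm (m x) ^+ 2] is the norm of [cmul (star x) (mstar m (m x))], hence the square root of
    [opnm (mmul (mstar m) m)] is a bound for [m]. *)
Let opnm_cstar m : opnm (mmul (mstar m) m) = opnm m ^+ 2.
Proof.
apply/eqP; rewrite eq_le.
have -> : opnm (mmul (mstar m) m) <= opnm m ^+ 2.
  by rewrite (le_trans (opnm_mul _ _))// opnm_star.
rewrite -[leRHS]sqr_sqrtr ?opnm_ge0// ler_sqr ?nnegrE ?opnm_ge0 ?sqrtr_ge0//.
apply: opnm_min; split; first exact: sqrtr_ge0.
move=> x; rewrite -ler_sqr ?nnegrE ?mulr_ge0 ?sqrtr_ge0 ?nm_ge0//.
rewrite exprMn sqr_sqrtr ?opnm_ge0// -nm_cstar mstarP.
rewrite (le_trans (nm_cmul _ _))// nm_star expr2 mulrCA ler_wpM2l ?nm_ge0//.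
exact: (opnmP (mmul (mstar m) m)).
Qed.
Let mcstar_norm (m : mult) : `|mmul (mstar m) m| = `|m| ^+ 2.
Proof. by rewrite !nmE -rmorphXn !nm_mult opnm_cstar. Qed.

(** Meant for [v n = u n x] and [t = nm x], with [u] a fast sequence of operators: an error
    proportional to [nm x] makes the pointwise limit a limit in operator norm. *)
Lemma fast_cauchy_pointwise (v : nat -> A) (t : R) : 0 <= t ->
    (forall n : nat, nm (v n.+1 - v n) <= t * 2^-1 ^+ n) ->
  exists l, forall n : nat, nm (l - v n) <= t * (2 * 2^-1 ^+ n).
Proof.
move=> t0 vt; have [t00|t00] := eqVneq t 0.
  exists (v 0%N) => n; rewrite t00 mul0r.
  suff -> : v n = v 0%N by rewrite subrr nm0.
  elim: n => [//|n <-]; apply/subr0_eq/nm_le0.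
  by have := vt n; rewrite t00 mul0r.
have {}t0 : 0 < t by rewrite lt_def t00.
have ti0 : 0 <= t^-1 by rewrite invr_ge0 ltW.
have [|l lP] := @fast_cauchy_cvg R A (fun n => (t^-1)%:C *: v n).
  by move=> n; rewrite -scalerBr nmZr// mulrC ler_pdivrMr// mulrC.
exists (t%:C *: l) => n.
have -> : t%:C *: l - v n = t%:C *: (l - (t^-1)%:C *: v n).
  by rewrite scalerBr scalerA -rmorphM divff// scale1r.
by rewrite nmZr ?(ltW t0)// ler_pM2l.
Qed.

(** [mstar] is isometric, so the adjoints of a fast sequence form a fast sequence too, and the two
    pointwise limits are adjoint to each other. *)
Let mult_complete (F : set_system mult) : ProperFilter F -> cauchy F -> cvg F.
Proof.
apply: fast_cauchy_cvg_complete => u fu.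
have lim (w : nat -> mult) : fast_cauchy w ->
    {l : A -> A | forall (n : nat) x, nm (l x - w n x) <= nm x * (2 * 2^-1 ^+ n)}.
  move=> fw; apply: cid.
  suff /choice[l lP] : forall x, exists y,
      forall n : nat, nm (y - w n x) <= nm x * (2 * 2^-1 ^+ n).
    by exists l => n x.
  move=> x; apply: fast_cauchy_pointwise; first exact: nm_ge0.
  move=> n; rewrite -mfunB (le_trans (opnmP _ _))// mulrC.
  by rewrite ler_wpM2l ?nm_ge0//; exact: fw.
have fs : fast_cauchy (mstar \o u).
  move=> n /=; rewrite nm_mult.
  have -> : mstar (u n.+1) - mstar (u n) = mstar (u n.+1 - u n).
    have := mstar_antilinear (-1) (u n) (u n.+1).
    rewrite rmorphN rmorph1 !scaleN1r [- u n + _]addrC => ->.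
    by rewrite addrC.
  by rewrite opnm_star; exact: fu.
have [l lP] := lim _ fu; have [l' l'P] := lim _ fs.
have ll' : is_adjoint l l'.
  move=> x y; apply/subr0_eq/nm_small => e e0.
  pose t := nm x * nm y.
  have t0 : 0 <= t by rewrite mulr_ge0 ?nm_ge0.
  have [|n ne] := @half_exp_small R (e / (4 * (t + 1))).
    by rewrite divr_gt0// mulr_gt0 ?ltr0n// ltr_wpDl.
  have -> : cmul (star (l x)) y - cmul (star x) (l' y) =
      cmul (star (l x - u n x)) y - cmul (star x) (l' y - mstar (u n) y).
    by rewrite starB cmulBl cmulBr mstarP opprB addrA subrK.
  apply: (le_lt_trans (nmB _ _)).
  have h1 : nm (cmul (star (l x - u n x)) y) <= 2 * t * 2^-1 ^+ n.
    rewrite (le_trans (nm_cmul _ _))// nm_star.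
    have := ler_wpM2r (nm_ge0 y) (lP n x); rewrite /t; lra.
  have h2 : nm (cmul (star x) (l' y - mstar (u n) y)) <= 2 * t * 2^-1 ^+ n.
    rewrite (le_trans (nm_cmul _ _))// nm_star.
    have := ler_wpM2l (nm_ge0 x) (l'P n y); rewrite /t /=; lra.
  move: ne; rewrite ltr_pdivlMr ?mulr_gt0 ?ltr0n// ?ltr_wpDl//.
  by have := @half_exp_gt0 R n; lra.
have lb : adjointable l.
  split; first by exists l'.
  exists (2 + opnm (u 0%N)); split; first by rewrite addr_ge0 ?opnm_ge0.
  move=> x; rewrite -[l x](subrK (u 0%N x)) (le_trans (nmD _ _))//.
  have := lP 0%N x; have := opnmP (u 0%N) x; rewrite expr0; lra.
exists (Mult lb) => n; rewrite nm_mult; apply: opnm_min.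
have n0 := @half_exp_gt0 R n.
split; first by rewrite mulr_ge0 ?ler0n// ltW.
move=> x; rewrite mfunB (le_trans (lP n x))// mulrC ler_wpM2r ?nm_ge0//.
by lra.
Qed.

HB.instance Definition _ := Uniform_isComplete.Build mult mult_complete.

HB.instance Definition _ := isCstarAlgebra.Build R mult mmulA mmul_linearl
  mmul_linearr mmul_norm mstarK mstarM mstar_antilinear mcstar_norm.

Lemma mfunM (m n : mult) x : cmul m n x = m (n x).
Proof. by []. Qed.

Lemma adjointable_cmul a : adjointable (cmul a).
Proof.
split; first by exists (cmul (star a)) => x y; rewrite starM cmulA.
by exists (nm a); split; [exact: nm_ge0 | move=> x; exact: nm_cmul].
Qed.

Definition mincl a : mult := Mult (adjointable_cmul a).

Lemma mincl_star_hom : star_hom mincl.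
Proof.
split.
- by move=> k a b; apply: mult_ext => x; rewrite mfunD mfunZ /= cmul_linearl.
- by move=> a b; apply: mult_ext => x; rewrite mfunM /= cmulA.
- move=> a; apply/esym/mstar_eq => x y.
  by rewrite /= starM cmulA.
Qed.

(** Evaluation at [star a] and the C*-identity. *)
Lemma nm_mincl a : nm a <= nm (mincl a).
Proof.
apply: sqr_le_nm; rewrite ?nm_ge0// -nm_cstarr -[in leRHS](nm_star a).
exact: (opnmP (mincl a)).
Qed.

End Multipliers.

Arguments mult {R} A.

(** * Closed spans and Hilbert bimodules *)

Lemma closed_lipschitz_preimage {R : realType} {V W : normedModType R[i]}
    (f : V -> W) (K : R) (S : set W) :
  0 <= K -> (forall u v, nm (f u - f v) <= K * nm (u - v)) -> closed S ->
  closed (f @^-1` S).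
Proof.
move=> K0 fK cS; apply: nm_closed => v h; apply: (closed_nm cS) => e e0.
have K1 : 0 < K + 1 by rewrite ltr_wpDl.
have [|u Su uv] := h (e / (K + 1)); first by rewrite divr_gt0.
exists (f u) => //; move: uv; rewrite ltr_pdivlMr// => uv.
by have := fK v u; have := nm_ge0 (v - u); lra.
Qed.

Lemma closed_span_ind {R : realType} {V : completeNormedModType R[i]}
    (S P : set V) :
  closed_span S = setT -> closed P -> linear_subspace P -> S `<=` P ->
  forall v, P v.
Proof.
move=> ST cP lP SP v; have : closed_span S v by rewrite ST.
by apply.
Qed.

Section Bimodule.
Context {R : realType} {A : cstarAlgType R} {X : hilbertBimodType A}.
Implicit Types (a b c : A) (x y z u v w : X).

Lemma nm_rip x : nm (rip x x : A) = nm x ^+ 2.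
Proof.
apply: (@complexI R).
by rewrite rmorphXn/= -!nmE (rip_norm x) sqrtCK.
Qed.

Lemma rip_ractl x y a : rip (ract x a) y = cmul (star a) (rip x y : A).
Proof. by rewrite rip_star rip_ract starM -rip_star. Qed.

Lemma lip_lactr x y a : lip x (lact a y) = cmul (lip x y : A) (star a).
Proof. by rewrite lip_star lip_lact starM -lip_star. Qed.

Lemma lip_ripE x y z : lact (lip x y : A) z = ract x (rip y z : A).
Proof. exact: lip_rip. Qed.

Lemma lip_eq0 x : lip x x = 0 :> A -> x = 0.
Proof.
move=> x0; apply: normr0_eq0.
by rewrite (lip_norm x) x0 normr0 sqrtC0.
Qed.

(* Both sides agree after multiplication by any [lip u v]: for those elements
   the identity comes from [lip_rip], and their span is an ideal. *)
Lemma lact_ract a x b : lact a (ract x b : X) = ract (lact a x : X) b.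
Proof.
have lip_assoc u v w c :
      lact (lip u v : A) (ract w c : X) = ract (lact (lip u v : A) w : X) c.
  by rewrite !lip_ripE rip_ract ractA.
apply/esym/subr0_eq; set d := _ - _; apply: lip_eq0.
have d0 u v : lact (lip u v : A) d = 0.
  rewrite /d (linB (lact_linearr _)) lip_assoc !lactA.
  rewrite -[a]starK -lip_lactr lip_assoc.
  by rewrite subrr.
have dd : cmul (lip d d : A) (lip d d) = 0.
  by rewrite -lip_lact d0 (lin0 (lip_linear d)).
by apply: cstar_eq0; rewrite -lip_star.
Qed.

End Bimodule.

(** * Extending representations to multipliers *)

Section Combination.
Context {R : realType} {A O : cstarAlgType R}.
Implicit Types (f g : A -> O) (s t : seq (A * O)).

(** The vector named by a formal sum of pairs. Keeping the list lets [T a z |-> f a z] be applied to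
    it before this is known to be well defined on vectors. *)
Definition comb f s : O := \sum_(p <- s) cmul (f p.1) p.2.

Lemma comb1 f a z : comb f [:: (a, z)] = cmul (f a) z.
Proof. by rewrite /comb big_seq1. Qed.

Lemma combD f s t : comb f (s ++ t) = comb f s + comb f t.
Proof. by rewrite /comb big_cat. Qed.

Lemma combZ f k s : comb f [seq (p.1, k *: p.2) | p <- s] = k *: comb f s.
Proof.
by rewrite /comb big_map scaler_sumr; apply: eq_bigr => p _; rewrite cmulZr.
Qed.

Lemma combMr f z s : comb f [seq (p.1, cmul p.2 z) | p <- s] = cmul (comb f s) z.
Proof.
elim: s => [|p s IH]; first by rewrite /comb !big_nil cmul0l.
rewrite /comb /= !big_cons -!/(comb f _) cmulDl -IH /comb.
by rewrite cmulA.
Qed.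

Lemma combB f s t :
  comb f (s ++ [seq (p.1, -1 *: p.2) | p <- t]) = comb f s - comb f t.
Proof. by rewrite combD combZ scaleN1r. Qed.

Lemma comb_mull f g (y z : O) s :
  (forall a, cmul y (f a) = cmul z (g a)) -> cmul y (comb f s) = cmul z (comb g s).
Proof.
move=> fg; elim: s => [|p s IH]; first by rewrite /comb !big_nil !cmul0r.
by rewrite /comb !big_cons -!/(comb _ _) !cmulDr IH !cmulA fg.
Qed.

(** Inner products of combinations depend only on those of the generators; this reduces adjointness
    and bounds to identities on generators. *)
Lemma comb_gram f g f' g' s t :
  (forall a b, cmul (star (f a)) (g b) = cmul (star (f' a)) (g' b)) ->
  cmul (star (comb f s)) (comb g t) = cmul (star (comb f' s)) (comb g' t).
Proof.
move=> h; apply: comb_mull => b; apply: (can_inj (@starK R O)).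
rewrite !starM !starK; apply: comb_mull => a.
by apply: (can_inj (@starK R O)); rewrite !starM !starK h.
Qed.

Lemma comb_linear (V : lmodType R[i]) (F : V -> A -> O) s :
  (forall a, linear (F^~ a)) -> linear (fun b => comb (F b) s).
Proof.
move=> linF k u v; rewrite /comb scaler_sumr -big_split /=.
by apply: eq_bigr => p _; rewrite linF cmulDl cmulZl.
Qed.

End Combination.

Section Extension.
Context {R : realType} {A O : cstarAlgType R} {T : A -> O}.
Hypothesis dense : forall (z : O) (e : R), 0 < e -> exists s, nm (z - comb T s) < e.

(** The difference is orthogonal to all combinations, hence by density to itself. *)
Lemma nondegenerate_eq (y z : O) :
  (forall a, cmul (star (T a)) y = cmul (star (T a)) z) -> y = z.
Proof.
move=> h; apply/subr0_eq; set d := y - z.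
have hd s : cmul (star d) (comb T s) = 0.
  rewrite -(cmul0l (comb T s)); apply: comb_mull => a.
  apply: (can_inj (@starK R O)).
  by rewrite !starM !starK star0 cmul0r cmulBr h subrr.
apply/cstar_eq0/nm_small => e e0.
have d1 : 0 < nm d + 1 by rewrite ltr_wpDl ?nm_ge0.
have [|s ds] := @dense d (e / (nm d + 1)); first by rewrite divr_gt0.
rewrite -[X in cmul _ X](subrK (comb T s)) cmulDr hd addr0.
apply: (le_lt_trans (nm_cmul _ _)); rewrite nm_star.
move: ds; rewrite ltr_pdivlMr//.
by have := nm_ge0 (d - comb T s); lra.
Qed.

Context {f f' : A -> O} {K : R}.
Hypotheses (K0 : 0 <= K)
  (ff' : forall a b, cmul (star (T a)) (f b) = cmul (star (f' a)) (T b))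
  (fK : forall s, nm (comb f s) <= K * nm (comb T s)).

(** [m] extends [comb T s |-> comb f s] by continuity. The second clause approximates [z] and [m z]
    by one and the same list, which is how properties of lists are carried over to [m]. *)
Lemma extension_exists : exists m : O -> O,
  (forall a z, cmul (star (T a)) (m z) = cmul (star (f' a)) z) /\
  forall z (e : R), 0 < e -> exists s, nm (z - comb T s) < e /\ nm (m z - comb f s) < e.
Proof.
suff /choice[m mP] : forall z, exists w,
    (forall a, cmul (star (T a)) w = cmul (star (f' a)) z) /\
    forall e : R, 0 < e -> exists s, nm (z - comb T s) < e /\ nm (w - comb f s) < e.
  by exists m; split=> [a z|z]; have [] := mP z.
(* With this precision two successive approximants of [z] differ by at most [2 * d n], and [K] times
   that is at most [2^-1 ^+ n]. *)
move=> z; pose d n := 2^-1 ^+ n / (2 * (K + 1)) : R.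
have K1 : 0 < K + 1 by rewrite ltr_wpDl.
have d0 n : 0 < d n.
  by rewrite divr_gt0 ?half_exp_gt0// mulr_gt0 ?ltr0n.
have dK n : 2 * (K * d n) <= 2^-1 ^+ n.
  rewrite /d !mulrA ler_pdivrMr ?mulr_gt0 ?ltr0n//.
  by have := @half_exp_gt0 R n; lra.
have d1 n : d n <= 2^-1 ^+ n.
  rewrite /d ler_pdivrMr ?mulr_gt0 ?ltr0n//.
  by have := mulr_ge0 K0 (ltW (@half_exp_gt0 R n)); have := @half_exp_gt0 R n; lra.
have dS n : d n.+1 <= d n.
  rewrite /d ler_pM2r ?invr_gt0 ?mulr_gt0 ?ltr0n//.
  by have := half_expS (R := R) n; have := @half_exp_gt0 R n.+1; lra.
pose s n := projT1 (cid (dense z (d0 n))).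
have sP n : nm (z - comb T (s n)) < d n := projT2 (cid (dense z (d0 n))).
have [|w wP] := @fast_cauchy_cvg R O (fun n => comb f (s n)).
  move=> n; rewrite -combB (le_trans (fK _))// combB.
  apply: le_trans (dK n); rewrite mulrCA ler_wpM2l//.
  have := nm_tri z (comb T (s n.+1)) (comb T (s n)).
  by rewrite (nm_dist _ z); have := sP n; have := sP n.+1; have := dS n; lra.
have app e : 0 < e -> exists s, nm (z - comb T s) < e /\ nm (w - comb f s) < e.
  move=> e0; have [|n ne] := @half_exp_small R (e / 2); first by lra.
  exists (s n); have := wP n; have := sP n; have := d1 n.
  by have := @half_exp_gt0 R n; lra.
exists w; split=> // a; apply/subr0_eq/nm_small => e e0.
pose L := nm (T a) + nm (f' a) + 1.
have L0 : 0 < L by rewrite /L; have := nm_ge0 (T a); have := nm_ge0 (f' a); lra.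
have [q q0 qe] : exists2 q, 0 < q & L * q = e.
  by exists (e / L); [rewrite divr_gt0 | rewrite mulrC divfK ?gt_eqF].
have [t [zt wt]] := app q q0.
have -> : cmul (star (T a)) w - cmul (star (f' a)) z =
    cmul (star (T a)) (w - comb f t) - cmul (star (f' a)) (z - comb T t).
  rewrite !cmulBr opprB addrA.
  by rewrite (comb_mull (f := f) (g := T) (z := star (f' a)))// subrK.
apply: (le_lt_trans (nmB _ _)).
have h1 := nm_cmul (star (T a)) (w - comb f t).
have h2 := nm_cmul (star (f' a)) (z - comb T t).
rewrite !nm_star in h1 h2.
have h3 := ler_wpM2l (nm_ge0 (T a)) (ltW wt).
have h4 := ler_wpM2l (nm_ge0 (f' a)) (ltW zt).
by move: qe; rewrite /L; lra.
Qed.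

End Extension.

(** [f'] is the candidate for the adjoint. Its bound is inherited by duality: [nm (comb f' s) ^+ 2]
    is the norm of [cmul (star (m (comb f' s))) (comb T s)]. Hence [f'] extends as well, to an
    adjoint of [m]. *)
Lemma multiplier_extension {R : realType} {A O : cstarAlgType R}
    {T f f' : A -> O} {K : R} :
  (forall (z : O) (e : R), 0 < e -> exists s, nm (z - comb T s) < e) ->
  0 <= K ->
  (forall a b, cmul (star (T a)) (f b) = cmul (star (f' a)) (T b)) ->
  (forall s, nm (comb f s) <= K * nm (comb T s)) ->
  exists m : mult O,
    (forall a z, cmul (star (T a)) (m z) = cmul (star (f' a)) z) /\
    (forall a, m (T a) = f a).
Proof.
move=> dense K0 ff' fK.
have f'f a b : cmul (star (T a)) (f' b) = cmul (star (f a)) (T b).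
  by apply: (can_inj (@starK R O)); rewrite !starM !starK ff'.
have [m [mT mapp]] := extension_exists dense K0 ff' fK.
have mcomb z s : cmul (star (m z)) (comb T s) = cmul (star z) (comb f' s).
  apply: comb_mull => a; apply: (can_inj (@starK R O)).
  by rewrite !starM !starK mT.
have mK z : nm (m z) <= K * nm z.
  rewrite -subr_le0; apply: le_of_lt_le => e e0.
  have [q q0 qe] : exists2 q, 0 < q & (K + 1) * q = e.
    have K1 : 0 < K + 1 by rewrite ltr_wpDl.
    by exists (e / (K + 1)); [rewrite divr_gt0 | rewrite mulrC divfK ?gt_eqF].
  have [t [zt mt]] := mapp z q q0.
  have := nm_tri (comb f t) (m z) 0; have := nm_tri z (comb T t) 0.
  rewrite !subr0 (nm_dist _ z) => h1 h2; have h3 := fK t.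
  have := ler_wpM2l K0 h1; have := ler_wpM2l K0 (ltW zt).
  by lra.
have f'K s : nm (comb f' s) <= K * nm (comb T s).
  apply: sqr_le_nm; rewrite ?mulr_ge0 ?nm_ge0//.
  rewrite -nm_cstar -mcomb (le_trans (nm_cmul _ _))// nm_star.
  by have := ler_wpM2r (nm_ge0 (comb T s)) (mK (comb f' s)); lra.
have [m' [m'T m'app]] := extension_exists dense K0 f'f f'K.
have mm' : is_adjoint m m'.
  move=> x y; apply/subr0_eq/nm_small => e e0.
  pose L := nm (m x) + nm x + 1.
  have L0 : 0 < L by rewrite /L; have := nm_ge0 (m x); have := nm_ge0 x; lra.
  have [q q0 qe] : exists2 q, 0 < q & L * q = e.
    by exists (e / L); [rewrite divr_gt0 | rewrite mulrC divfK ?gt_eqF].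
  have [t [yt mt]] := m'app y q q0.
  have -> : cmul (star (m x)) y - cmul (star x) (m' y) =
      cmul (star (m x)) (y - comb T t) - cmul (star x) (m' y - comb f' t).
    by rewrite !cmulBr opprB addrA mcomb subrK.
  apply: (le_lt_trans (nmB _ _)).
  have h1 := nm_cmul (star (m x)) (y - comb T t).
  have h2 := nm_cmul (star x) (m' y - comb f' t).
  rewrite !nm_star in h1 h2.
  have h3 := ler_wpM2l (nm_ge0 (m x)) (ltW yt).
  have h4 := ler_wpM2l (nm_ge0 x) (ltW mt).
  by move: qe; rewrite /L; lra.
have okm : adjointable m.
  by split; [exists m' | exists K; split].
exists (Mult okm); split=> //= a.
by apply: (nondegenerate_eq dense) => b; rewrite mT ff'.
Qed.

(** * Nondegeneracy of the universal representation *)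

Section CovariantRep.
Context {R : realType} {A : cstarAlgType R} {X : hilbertBimodType A}.
Context {O : cstarAlgType R} {TX : X -> O} {TA : A -> O}.
Hypothesis cov : covariant_rep TX TA.

Lemma nm_rep_le x : nm (TX x) <= 2 * nm x.
Proof.
have [[_ hTA] _ _ ripT _] := cov.
rewrite -ler_sqr ?nnegrE ?mulr_ge0 ?nm_ge0//.
rewrite -nm_cstar -ripT (le_trans (star_hom_bounded hTA _))// nm_rip exprMn.
by have := sqr_ge0 (nm x); lra.
Qed.

Let F : set O := [set z | forall e : R, 0 < e -> exists s, nm (z - comb TA s) < e].

Let F_closed : closed F.
Proof.
apply: nm_closed => v h e e0.
have e2 : 0 < e / 2 by rewrite divr_gt0.
have [u Fu vu] := h _ e2; have [s us] := Fu _ e2.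
by exists s; have := nm_tri u v (comb TA s); lra.
Qed.

Let F_subspace : linear_subspace F.
Proof.
split=> [e e0|k u v Fu Fv e e0].
  by exists [::]; rewrite /comb big_nil subrr nm0.
have k0 : 0 <= complex.Re `|k| by rewrite -ler0c RRe_real// ger0_real.
have k1 : 0 < complex.Re `|k| + 1 by rewrite ltr_wpDl.
have [q q0 qe] : exists2 q, 0 < q & (complex.Re `|k| + 1) * q = e.
  exists (e / (complex.Re `|k| + 1)); first by rewrite divr_gt0.
  by rewrite mulrC divfK ?gt_eqF.
have [s us] := Fu q q0; have [t vt] := Fv q q0.
exists ([seq (p.1, k *: p.2) | p <- s] ++ t).
rewrite combD combZ opprD addrACA -scalerBr.
apply: (le_lt_trans (nmD _ _)); rewrite nmZ.
by have := ler_wpM2l k0 (ltW us); lra.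
Qed.

Let F_mull a z : F (cmul (TA a) z).
Proof. by move=> e e0; exists [:: (a, z)]; rewrite comb1 subrr nm0. Qed.

Let F_mulr z y : F z -> F (cmul z y).
Proof.
move=> Fz e e0; have y1 : 0 < nm y + 1 by rewrite ltr_wpDl ?nm_ge0.
have [|s zs] := Fz (e / (nm y + 1)); first by rewrite divr_gt0.
exists [seq (p.1, cmul p.2 y) | p <- s].
rewrite combMr -cmulBl (le_lt_trans (nm_cmul _ _))//.
move: zs; rewrite ltr_pdivlMr//.
by have := nm_ge0 (z - comb TA s); lra.
Qed.

(* [a] is the limit of [a - C a], in the closed ideal generated by [a a^*]. *)
Let F_alg a : F (TA a).
Proof.
have [[_ hTA] _ _ _ _] := cov; have [linT TM _] := hTA.
pose N := TA @^-1` F.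
have lipT u v : nm (TA u - TA v) <= 2 * nm (u - v).
  by rewrite -(linB linT) star_hom_bounded.
have cN : closed N by apply: closed_lipschitz_preimage lipT F_closed.
have sN : linear_subspace N.
  have [F0 FD] := F_subspace.
  split=> [|k u v]; rewrite /N /= ?(lin0 linT) ?linT//; exact: FD.
have idN : cstar_ideal N.
  split=> // [b c _|b c Nb]; rewrite /N /= TM; first exact: F_mull.
  exact: F_mulr.
have Naa : N (cmul a (star a)) by rewrite /N /= TM; exact: F_mull.
suff : N a by [].
apply: (closed_nm cN) => e e0.
have saa : star (cmul a (star a)) = cmul a (star a) by rewrite starM starK.
have [|C [linC CM nmC NC Ca]] := ideal_contraction (e := (e / 2) ^+ 2) idN Naa saa.
  by rewrite exprn_gt0// divr_gt0.
exists (a - C a) => //; rewrite subKr.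
suff : nm (C a) <= e / 2 by lra.
rewrite -ler_sqr ?nnegrE ?nm_ge0 ?divr_ge0 ?ler0n ?(ltW e0)//.
by rewrite -nm_cstarr contraction_cstar// (le_trans (nmC _))// nm_star.
Qed.

Hypothesis gen : smallest (@cstar_subalgebra R O) (range TX `|` range TA) = setT.

(** [F] is a closed right ideal. It contains the range of [TX] as left multiples [a x] span [X], and
    the adjoints of that range as right multiples [x a] do, since [star (TX (ract x a))] begins with
    [TA (star a)]. The elements lying in [F] with their adjoints then form a C*-subalgebra
    containing the generators. *)
Lemma rep_dense (z : O) (e : R) : 0 < e -> exists s, nm (z - comb TA s) < e.
Proof.
move: e; rewrite -/(F z).
have [[linX hTA] TXr TXl _ _] := cov; have [linT TM Ts] := hTA.
have [F0 FD] := F_subspace.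
have lipX u v : nm (TX u - TX v) <= 2 * nm (u - v).
  by rewrite -(linB linX) nm_rep_le.
have FX x : F (TX x).
  apply: (closed_span_ind (P := TX @^-1` F)) (lact_nondegenerate (s := X)) _ _ _ x.
  - exact: closed_lipschitz_preimage lipX F_closed.
  - by split=> [|k u v]; rewrite /= ?(lin0 linX) ?linX//; exact: FD.
  - by move=> _ [a _ [y _ <-]]; rewrite /= TXl; exact: F_mull.
have FXs x : F (star (TX x)).
  apply: (closed_span_ind (P := (star \o TX) @^-1` F))
    (ract_nondegenerate (s := X)) _ _ _ x.
  - apply: (@closed_lipschitz_preimage _ _ _ _ 2) F_closed => // u v.
    by rewrite /= -starB nm_star.
  - split=> [|k u v]; rewrite /= ?(lin0 linX) ?star0//.
    by rewrite linX star_antilinear; exact: FD.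
  - by move=> _ [y _ [a _ <-]]; rewrite /= TXr starM -Ts; exact: F_mull.
suff : [set z | F z /\ F (star z)] z by case.
have : smallest (@cstar_subalgebra R O) (range TX `|` range TA) z by rewrite gen.
apply; split; last first.
  by move=> _ [[x _ <-]|[a _ <-]]; split=> //; rewrite -Ts.
split.
- apply: closedI; first exact: F_closed.
  apply: (@closed_lipschitz_preimage _ _ _ (@star R O) 1) F_closed => // u v.
  by rewrite -starB nm_star mul1r.
- split=> [|k u v [Fu Fus] [Fv Fvs]]; first by rewrite /= star0.
  by split; [exact: FD | rewrite star_antilinear; exact: FD].
- move=> u v [Fu Fus] [Fv Fvs]; split; first exact: F_mulr.
  by rewrite starM; exact: F_mulr.
- by move=> u [Fu Fus]; split; rewrite ?starK.
Qed.

End CovariantRep.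

(** * Action of the larger bimodule by multipliers *)

Section ExtendRep.
Context {R : realType} {A B : cstarAlgType R}.
Context {X : hilbertBimodType A} {Y : hilbertBimodType B}.
Context {psiX : X -> Y} {psiA : A -> B}.
Context {O : cstarAlgType R} {TX : X -> O} {TA : A -> O}.
Hypotheses (morph : bimod_morphism psiX psiA)
  (isoA : forall a, `|psiA a| = `|a|)
  (idA : cstar_ideal (range psiA))
  (YA : forall y a, exists x, psiX x = ract y (psiA a))
  (AY : forall a y, exists x, psiX x = lact (psiA a) y)
  (cov : covariant_rep TX TA)
  (dense : forall (z : O) (e : R), 0 < e -> exists s, nm (z - comb TA s) < e).

Let linX : linear psiX. Proof. by case: morph => [[]]. Qed.
Let linA : linear psiA. Proof. by case: morph => [[_ []]]. Qed.
Let psiM a b : psiA (cmul a b) = cmul (psiA a) (psiA b).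
Proof. by case: morph => [[_ []]]. Qed.
Let psiS a : psiA (star a) = star (psiA a).
Proof. by case: morph => [[_ []]]. Qed.
Let psi_ract x a : psiX (ract x a) = ract (psiX x) (psiA a).
Proof. by case: morph. Qed.
Let psi_lact a x : psiX (lact a x) = lact (psiA a) (psiX x).
Proof. by case: morph. Qed.
Let psi_rip x y : psiA (rip x y) = rip (psiX x) (psiX y).
Proof. by case: morph. Qed.
Let psi_lip x y : psiA (lip x y) = lip (psiX x) (psiX y).
Proof. by case: morph. Qed.

Let psiA_inj : injective psiA.
Proof.
move=> a b ab; apply/subr0_eq/normr0_eq0.
by rewrite -isoA (linB linA) ab subrr normr0.
Qed.

Let psiX_inj : injective psiX.
Proof.
move=> x y xy; apply/subr0_eq; set d := x - y.
have d0 : psiX d = 0 by rewrite (linB linX) xy subrr.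
apply: normr0_eq0; rewrite (rip_norm d) -isoA psi_rip d0.
by rewrite (lin0 (rip_linear _)) normr0 sqrtC0.
Qed.

Let linTX : linear TX. Proof. by case: cov => [[]]. Qed.
Let linTA : linear TA. Proof. by case: cov => [[_ []]]. Qed.
Let TM a b : TA (cmul a b) = cmul (TA a) (TA b).
Proof. by case: cov => [[_ []]]. Qed.
Let TS a : TA (star a) = star (TA a).
Proof. by case: cov => [[_ []]]. Qed.
Let T_ract x a : TX (ract x a) = cmul (TX x) (TA a).
Proof. by case: cov. Qed.
Let T_lact a x : TX (lact a x) = cmul (TA a) (TX x).
Proof. by case: cov. Qed.
Let T_rip x y : TA (rip x y) = cmul (star (TX x)) (TX y).
Proof. by case: cov. Qed.
Let T_lip x y : TA (lip x y) = cmul (TX x) (star (TX y)).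
Proof. by case: cov. Qed.

(** [la], [ra], [lx], [rx] are the products [b a], [a b], [y a], [a y], pulled back to [A] or [X].
    Identities between them are verified in [B] or [Y], after applying the injective [psiA] or
    [psiX]. *)
Let la_spec : {la : B -> A -> A | forall b a, psiA (la b a) = cmul b (psiA a)}.
Proof.
apply: cid; have [_ _ Il _] := idA.
suff /choice[f fP] : forall p : B * A, exists c, psiA c = cmul p.1 (psiA p.2).
  by exists (fun b a => f (b, a)) => b a; rewrite fP.
move=> [b a]; have [|c _ cE] := Il b (psiA a); first by exists a.
by exists c.
Qed.
Let la := sval la_spec.
Let laE : forall b a, psiA (la b a) = cmul b (psiA a) := svalP la_spec.

Let ra a b := star (la (star b) (star a)).
Let raE a b : psiA (ra a b) = cmul (psiA a) b.
Proof. by rewrite psiS laE psiS starM !starK. Qed.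

Let lx_spec : {lx : Y -> A -> X | forall y a, psiX (lx y a) = ract y (psiA a)}.
Proof.
apply: cid.
suff /choice[f fP] : forall p : Y * A, exists c, psiX c = ract p.1 (psiA p.2).
  by exists (fun b a => f (b, a)) => b a; rewrite fP.
by move=> [y a]; exact: YA.
Qed.
Let lx := sval lx_spec.
Let lxE : forall y a, psiX (lx y a) = ract y (psiA a) := svalP lx_spec.

Let rx_spec : {rx : A -> Y -> X | forall a y, psiX (rx a y) = lact (psiA a) y}.
Proof.
apply: cid.
suff /choice[f fP] : forall p : A * Y, exists c, psiX c = lact (psiA p.1) p.2.
  by exists (fun b a => f (b, a)) => b a; rewrite fP.
by move=> [a y]; exact: AY.
Qed.
Let rx := sval rx_spec.
Let rxE : forall a y, psiX (rx a y) = lact (psiA a) y := svalP rx_spec.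

Let la_gram b c u v :
  cmul (star (TA (la b u))) (TA (la c v)) =
  cmul (star (TA u)) (TA (la (cmul (star b) c) v)).
Proof.
rewrite -!TS -!TM; congr TA; apply: psiA_inj.
by rewrite !psiM !psiS !laE starM -!cmulA.
Qed.

Let la_linear a : linear (fun b => TA (la b a)).
Proof.
move=> k b c /=; rewrite -linTA; congr TA; apply: psiA_inj.
by rewrite linA !laE cmul_linearl.
Qed.

(** [action_bound] for [B] acting on the single vector [comb TA s]. *)
Let la_bound b s :
  nm (comb (fun a => TA (la b a)) s) <= 2 * nm b * nm (comb TA s).
Proof.
apply: (@action_bound R B O (fun b => comb (fun a => TA (la b a)) s)).
- by apply: (comb_linear (F := fun b a => TA (la b a))) => a; exact: la_linear.
- by move=> c d; apply: comb_gram => u v; rewrite la_gram.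
- move=> c; apply: comb_gram => u v.
  rewrite -!TS -!TM; congr TA; apply: psiA_inj.
  by rewrite !psiM !psiS !laE starM -!cmulA.
Qed.

Let multB b : {m : mult O | (forall a z, cmul (TA a) (m z) = cmul (TA (ra a b)) z) &
  forall a, m (TA a) = TA (la b a)}.
Proof.
apply: cid2.
have [|||m [m1 m2]] := @multiplier_extension R A O TA (fun a => TA (la b a))
  (fun a => TA (la (star b) a)) (2 * nm b) dense.
- by rewrite mulr_ge0 ?nm_ge0.
- move=> u v; rewrite -!TS -!TM; congr TA; apply: psiA_inj.
  by rewrite !psiM !psiS !laE starM starK -!cmulA.
- exact: la_bound.
exists m => // a z; have := m1 (star a) z.
by rewrite -!TS starK.
Qed.

(** The adjoint sends [TA a] to [star (TX (rx (star a) y))], formally [y^* a]; adjointness is the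
    associativity [lact_ract] in [Y]. For the bound, the Gram matrix of the [TX (lx y a)] is that of
    the action of [rip y y], already bounded by [la_bound]. *)
Let multY y : {m : mult O | (forall a z, cmul (TA a) (m z) = cmul (TX (rx a y)) z) &
  forall a, m (TA a) = TX (lx y a)}.
Proof.
apply: cid2.
have [|||m [m1 m2]] := @multiplier_extension R A O TA (fun a => TX (lx y a))
  (fun a => star (TX (rx (star a) y))) (2 * nm y) dense.
- by rewrite mulr_ge0 ?nm_ge0.
- move=> u v; rewrite starK -TS -T_lact -T_ract; congr TX; apply: psiX_inj.
  by rewrite psi_lact psi_ract lxE rxE lact_ract.
- move=> s; rewrite -ler_sqr ?nnegrE ?mulr_ge0 ?nm_ge0// -nm_cstar.
  rewrite (comb_gram (f' := TA) (g' := fun a => TA (la (rip y y : B) a))).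
    rewrite (le_trans (nm_cmul _ _))// nm_star.
    have := ler_wpM2l (nm_ge0 (comb TA s)) (la_bound (rip y y) s).
    rewrite nm_rip => /le_trans; apply.
    rewrite !exprMn; have := sqr_ge0 (nm y * nm (comb TA s)).
    by rewrite exprMn; lra.
  move=> u v; rewrite -T_rip -TS -TM; congr TA; apply: psiA_inj.
  by rewrite psi_rip !lxE psiM psiS laE rip_ract rip_ractl cmulA.
exists m => // a z; have := m1 (star a) z.
by rewrite -!TS !starK.
Qed.

Let MB b : mult O := s2val (multB b).
Let MBl b a z : cmul (TA a) (MB b z) = cmul (TA (ra a b)) z.
Proof. exact: (s2valP (multB b)). Qed.
Let MBr b a : MB b (TA a) = TA (la b a).
Proof. exact: (s2valP' (multB b)). Qed.
Let MY y : mult O := s2val (multY y).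
Let MYl y a z : cmul (TA a) (MY y z) = cmul (TX (rx a y)) z.
Proof. exact: (s2valP (multY y)). Qed.
Let MYr y a : MY y (TA a) = TX (lx y a).
Proof. exact: (s2valP' (multY y)). Qed.

Let TA_cancel (u v : O) : (forall a, cmul (TA a) u = cmul (TA a) v) -> u = v.
Proof. by move=> h; apply: (nondegenerate_eq dense) => a; rewrite -TS. Qed.

(** The values on the range of [TA] determine [star m], because [cmul (star (TA a)) (star m z)]
    equals [cmul (star (m (TA a))) z]. *)
Let mult_eq (m n : mult O) : (forall a, m (TA a) = n (TA a)) -> m = n.
Proof.
move=> h; apply: (can_inj (@starK R (mult O))); apply: mult_ext => z.
apply: (nondegenerate_eq dense) => a; apply: (can_inj (@starK R O)).
by rewrite !starM !starK !(is_adjoint_sym (@mstarP R O _)) h.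
Qed.

Let mstar_TA (m : mult O) a z : cmul (TA a) (star m z) = cmul (star (m (TA (star a)))) z.
Proof. by rewrite mstarP TS starK. Qed.

(** Each relation is tested on some [TA a] by [mult_eq] and, where needed, against [TA c] on the
    left. It then becomes an identity inside [A] or [X]. *)
Lemma extend_rep : exists (tY : Y -> mult O) (tB : B -> mult O),
  [/\ covariant_rep tY tB, tY \o psiX = mincl \o TX & tB \o psiA = mincl \o TA].
Proof.
exists MY, MB; split; first split; first split; [|split|..].
- move=> k y y'; apply: mult_eq => a; rewrite mfunD mfunZ !MYr -linTX.
  congr TX; apply: psiX_inj; rewrite linX !lxE.
  by rewrite ract_linearl.
- move=> k b b'; apply: mult_eq => a; rewrite mfunD mfunZ !MBr.
  exact: la_linear.
- move=> b b'; apply: mult_eq => a; rewrite mfunM !MBr.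
  by congr TA; apply: psiA_inj; rewrite !laE cmulA.
- move=> b; apply: mult_eq => a; rewrite MBr; apply: TA_cancel => c.
  rewrite mstar_TA MBr -TS -!TM; congr TA; apply: psiA_inj.
  by rewrite !psiM psiS !laE psiS starM !starK cmulA.
- move=> y b; apply: mult_eq => a; rewrite mfunM MBr !MYr.
  congr TX; apply: psiX_inj; rewrite !lxE laE.
  by rewrite ractA.
- move=> b y; apply: mult_eq => a; rewrite mfunM !MYr; apply: TA_cancel => c.
  rewrite MBl -!T_lact; congr TX; apply: psiX_inj.
  by rewrite !psi_lact !lxE raE !lact_ract !lactA.
- move=> y y'; apply: mult_eq => a; rewrite mfunM MYr MBr; apply: TA_cancel => c.
  rewrite mstar_TA MYr -T_rip -TM; congr TA; apply: psiA_inj.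
  by rewrite psiM laE psi_rip !lxE rip_ract rip_ractl psiS starK cmulA.
- move=> y y'; apply: mult_eq => a; rewrite mfunM MBr; apply: TA_cancel => c.
  have -> : star (MY y') (TA a) = star (TX (rx (star a) y')).
    apply: star_cmul_inj => z; rewrite starK (is_adjoint_sym (@mstarP R O _)).
    by rewrite -TS MYl.
  rewrite MYl -T_lip -TM; congr TA; apply: psiA_inj.
  by rewrite psiM laE psi_lip !rxE lip_lact lip_lactr psiS starK cmulA.
- apply/funext => x; apply: mult_eq => a; rewrite /= MYr -T_ract.
  by congr TX; apply: psiX_inj; rewrite lxE psi_ract.
- apply/funext => b; apply: mult_eq => a; rewrite /= MBr -TM.
  by congr TA; apply: psiA_inj; rewrite laE psiM.
Qed.

End ExtendRep.

(** * The short exact sequence *)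

Lemma cuntz_pimsner_eq {R : realType} {A : cstarAlgType R} {X : hilbertBimodType A}
    {O D : cstarAlgType R} {TX : X -> O} {TA : A -> O} {f g : O -> D} :
  cuntz_pimsner TX TA -> star_hom f -> star_hom g ->
  f \o TX = g \o TX -> f \o TA = g \o TA -> f = g.
Proof.
move=> [_ gen _] hf hg fgX fgA; apply: (star_hom_eq hf hg gen).
move=> _ [[x _ <-]|[a _ <-]]; first by have := congr1 (@^~ x) fgX.
by have := congr1 (@^~ a) fgA.
Qed.

Lemma covariant_rep_comp {R : realType} {A B : cstarAlgType R}
    {X : hilbertBimodType A} {Y : hilbertBimodType B} {D : cstarAlgType R}
    {psiX : X -> Y} {psiA : A -> B} {tY : Y -> D} {tB : B -> D} :
  bimod_morphism psiX psiA -> covariant_rep tY tB ->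
  covariant_rep (tY \o psiX) (tB \o psiA).
Proof.
move=> [[lX [lA psiM psiS]] pXr pXl prip plip] [[lY [lB tM tS]] tYr tYl trip tlip].
split; first split; first by move=> k u v; rewrite /= lX lY.
- split=> [k u v|a b|a] /=; first by rewrite lA lB.
    by rewrite psiM tM.
  by rewrite psiS tS.
- by move=> x a /=; rewrite pXr tYr.
- by move=> a x /=; rewrite pXl tYl.
- by move=> x y /=; rewrite prip trip.
- by move=> x y /=; rewrite plip tlip.
Qed.

Lemma star_hom_comp {R : realType} {A B D : cstarAlgType R}
    {f : A -> B} {g : B -> D} : star_hom f -> star_hom g -> star_hom (g \o f).
Proof.
move=> [lf fM fS] [lg gM gS]; split=> [k u v|a b|a] /=.
- by rewrite lf lg.
- by rewrite fM gM.
- by rewrite fS gS.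
Qed.

Lemma star_hom0 {R : realType} {A B : cstarAlgType R} :
  @star_hom R A B (fun=> 0).
Proof.
split=> [k u v|a b|a]; first by rewrite scaler0 addr0.
  by rewrite cmul0l.
by rewrite star0.
Qed.

Lemma star_hom_id {R : realType} {A : cstarAlgType R} : star_hom (@idfun A).
Proof. by []. Qed.

Lemma induced_hom_exists {R : realType} {A B : cstarAlgType R}
    {X : hilbertBimodType A} {Y : hilbertBimodType B} {OX OY : cstarAlgType R}
    {TX : X -> OX} {TA : A -> OX} {TY : Y -> OY} {TB : B -> OY}
    {psiX : X -> Y} {psiA : A -> B} :
  bimod_morphism psiX psiA -> cuntz_pimsner TX TA -> covariant_rep TY TB ->
  exists Psi, induced_hom TX TA TY TB psiX psiA Psi.
Proof.
move=> morph HX covY; have [_ _ univ] := HX.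
have [Psi [hPsi PX PA]] := univ _ _ _ (covariant_rep_comp morph covY).
exists Psi; split=> // F [hF FX FA].
by apply: (cuntz_pimsner_eq HX hPsi hF); rewrite ?PX ?PA.
Qed.

(** The lower bound turns approximations [f (u n)] of a limit point into a fast sequence [u]; [d] is
    scaled as in [extension_exists]. *)
Lemma closed_range {R : realType} {V W : completeNormedModType R[i]}
    {f : V -> W} {K L : R} : linear f -> 0 <= K -> 0 <= L ->
  (forall v, nm (f v) <= L * nm v) -> (forall v, nm v <= K * nm (f v)) ->
  closed (range f).
Proof.
move=> linf K0 L0 fL fK; apply: nm_closed => w h.
pose d n := 2^-1 ^+ n / (2 * (K + 1)) : R.
have K1 : 0 < K + 1 by rewrite ltr_wpDl.
have d0 n : 0 < d n.
  by rewrite divr_gt0 ?half_exp_gt0// mulr_gt0 ?ltr0n.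
have dK n : 2 * (K * d n) <= 2^-1 ^+ n.
  rewrite /d !mulrA ler_pdivrMr ?mulr_gt0 ?ltr0n//.
  by have := @half_exp_gt0 R n; lra.
have d1 n : d n <= 2^-1 ^+ n.
  rewrite /d ler_pdivrMr ?mulr_gt0 ?ltr0n//.
  by have := mulr_ge0 K0 (ltW (@half_exp_gt0 R n)); have := @half_exp_gt0 R n; lra.
have dS n : d n.+1 <= d n.
  rewrite /d ler_pM2r ?invr_gt0 ?mulr_gt0 ?ltr0n//.
  by have := half_expS (R := R) n; have := @half_exp_gt0 R n.+1; lra.
have /choice[u uP] n : exists v, nm (w - f v) < d n.
  by have [_ [v _ <-] wv] := h _ (d0 n); exists v.
have [|v vP] := @fast_cauchy_cvg R V u.
  move=> n; rewrite (le_trans (fK _))// (linB linf).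
  apply: le_trans (dK n); rewrite mulrCA ler_wpM2l//.
  have := nm_tri w (f (u n.+1)) (f (u n)).
  by rewrite (nm_dist _ w); have := uP n; have := uP n.+1; have := dS n; lra.
exists v => //; apply/esym/subr0_eq/nm_small => e e0.
(* 1 for the distance from [w] to [f (u n)], [2 * L] for that from [f (u n)] to [f v]. *)
have [q q0 qe] : exists2 q, 0 < q & (1 + 2 * L) * q = e.
  have L1 : 0 < 1 + 2 * L by rewrite ltr_pwDl// mulr_ge0.
  by exists (e / (1 + 2 * L)); [rewrite divr_gt0 | rewrite mulrC divfK ?gt_eqF].
have [n nq] := half_exp_small q0.
have := nm_tri (f (u n)) w (f v); rewrite -(linB linf) => h1.
have h2 := fL (u n - v); rewrite (nm_dist (u n)) in h2.
have := ler_wpM2l L0 (vP n); have := ler_wpM2l L0 (ltW nq).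
by have := uP n; have := d1 n; lra.
Qed.

Section ExactSequence.
Context {R : realType} {A B E : cstarAlgType R}.
Context {X : hilbertBimodType A} {Y : hilbertBimodType B} {Z : hilbertBimodType E}.
Context {psiX : X -> Y} {psiA : A -> B} {qY : Y -> Z} {qB : B -> E}.
Context {OX OY OZ : cstarAlgType R}.
Context {TX : X -> OX} {TA : A -> OX} {TY : Y -> OY} {TB : B -> OY}.
Context {TZ : Z -> OZ} {TE : E -> OZ}.
Hypotheses (Hext : bimod_extension psiX psiA)
  (Hquo : bimod_quotient psiX psiA qY qB)
  (HOX : cuntz_pimsner TX TA) (HOY : cuntz_pimsner TY TB)
  (HOZ : cuntz_pimsner TZ TE).

Let morph : bimod_morphism psiX psiA. Proof. by case: Hext. Qed.
Let qmorph : bimod_morphism qY qB. Proof. by case: Hquo. Qed.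

Lemma qB_psiA a : qB (psiA a) = 0.
Proof.
have [_ _ [_ _ [_ _ ker _ _]]] := Hquo.
have : range psiA (psiA a) by exists a.
by rewrite -ker.
Qed.

Lemma qY_psiX x : qY (psiX x) = 0.
Proof.
have [_ [_ _ ker _ _] _] := Hquo.
have : range psiX (psiX x) by exists x.
by rewrite -ker.
Qed.

Lemma qY_eq0 y : qY y = 0 -> exists x, psiX x = y.
Proof.
have [_ [_ _ ker _ _] _] := Hquo => y0.
have : (qY @^-1` [set 0]) y by [].
by rewrite ker => -[x _ <-]; exists x.
Qed.

Lemma qB_eq0 b : qB b = 0 -> exists a, psiA a = b.
Proof.
have [_ _ [_ _ [_ _ ker _ _]]] := Hquo => b0.
have : (qB @^-1` [set 0]) b by [].
by rewrite ker => -[a _ <-]; exists a.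
Qed.

Lemma ract_psiA y a : exists x, psiX x = ract y (psiA a).
Proof.
have [_ qr _ _ _] := qmorph; apply: qY_eq0.
by rewrite qr qB_psiA (lin0 (ract_linearr _)).
Qed.

Lemma lact_psiA a y : exists x, psiX x = lact (psiA a) y.
Proof.
have [_ _ ql _ _] := qmorph; apply: qY_eq0.
by rewrite ql qB_psiA (lin0 (lact_linearl _)).
Qed.

Context {Psi : OX -> OY} {Q : OY -> OZ}.
Hypotheses (HPsi : induced_hom TX TA TY TB psiX psiA Psi)
  (HQ : induced_hom TY TB TZ TE qY qB Q).

Let hPsi : star_hom Psi. Proof. by case: HPsi => [[]]. Qed.
Let hQ : star_hom Q. Proof. by case: HQ => [[]]. Qed.
Let PsiX x : Psi (TX x) = TY (psiX x).
Proof. by case: HPsi => [[_ /(congr1 (@^~ x))]]. Qed.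
Let PsiA a : Psi (TA a) = TB (psiA a).
Proof. by case: HPsi => [[_ _ /(congr1 (@^~ a))]]. Qed.
Let QY y : Q (TY y) = TZ (qY y).
Proof. by case: HQ => [[_ /(congr1 (@^~ y))]]. Qed.
Let QB b : Q (TB b) = TE (qB b).
Proof. by case: HQ => [[_ _ /(congr1 (@^~ b))]]. Qed.

Let covX : covariant_rep TX TA. Proof. by case: HOX. Qed.
Let covY : covariant_rep TY TB. Proof. by case: HOY. Qed.
Let covZ : covariant_rep TZ TE. Proof. by case: HOZ. Qed.

Let dense (z : OX) (e : R) : 0 < e -> exists s, nm (z - comb TA s) < e.
Proof. by apply: (rep_dense covX); case: HOX. Qed.

(* The representation of [Y] by multipliers of [OX] that extends the universal
   one of [X] induces a left inverse of [Psi]. *)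
Lemma nm_Psi z : nm z <= 2 * nm (Psi z).
Proof.
have [_ isoA idA _] := Hext.
have [tY [tB [cov tX tA]]] :=
  extend_rep morph isoA idA ract_psiA lact_psiA covX dense.
have [_ _ univ] := HOY; have [Phi [hPhi PhiY PhiB]] := univ _ _ _ cov.
have PhiPsi : Phi \o Psi = mincl.
  apply: (cuntz_pimsner_eq HOX (star_hom_comp hPsi hPhi) mincl_star_hom).
  - rewrite -tX -PhiY; apply/funext => x.
    by rewrite /= PsiX.
  - rewrite -tA -PhiB; apply/funext => a.
    by rewrite /= PsiA.
rewrite (le_trans (nm_mincl z))// -PhiPsi.
exact: (star_hom_bounded hPhi).
Qed.

Lemma Psi_inj : injective Psi.
Proof.
have [linP _ _] := hPsi => u v uv; apply/subr0_eq/nm_le0.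
by rewrite (le_trans (nm_Psi _))// (linB linP) uv subrr nm0 mulr0.
Qed.

Let N := range Psi.

Let N_closed : closed N.
Proof.
have [linP _ _] := hPsi.
exact: (closed_range linP (ler0n _ 2) (ler0n _ 2) (star_hom_bounded hPsi) nm_Psi).
Qed.

Let N_subspace : linear_subspace N.
Proof.
have [linP _ _] := hPsi; split; first by exists 0 => //; exact: lin0.
by move=> k _ _ [u _ <-] [v _ <-]; exists (k *: u + v); rewrite ?linP.
Qed.

Let N_mul u v : N u -> N v -> N (cmul u v).
Proof.
have [_ PM _] := hPsi; move=> [x _ <-] [y _ <-].
by exists (cmul x y); rewrite ?PM.
Qed.

Let N_star u : N u -> N (star u).
Proof. by have [_ _ PS] := hPsi; move=> [x _ <-]; exists (star x); rewrite ?PS. Qed.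

(** Combinations of the [TA a] are dense in [OX], and [N] is a closed subalgebra. *)
Let N_absorb w : (forall a, N (cmul w (Psi (TA a)))) -> forall z, N (cmul w (Psi z)).
Proof.
have [linP PM _] := hPsi => h z; apply: (closed_nm N_closed) => e e0.
have w1 : 0 < 2 * nm w + 1 by rewrite ltr_wpDl// mulr_ge0 ?nm_ge0.
have [q q0 qe] : exists2 q, 0 < q & (2 * nm w + 1) * q = e.
  by exists (e / (2 * nm w + 1)); [rewrite divr_gt0 | rewrite mulrC divfK ?gt_eqF].
have [s zs] := dense z q0.
exists (cmul w (Psi (comb TA s))).
  rewrite /comb; elim: s {zs} => [|p s IH].
    by rewrite big_nil (lin0 linP) cmul0r; case: N_subspace.
  rewrite big_cons (linD linP) cmulDr; apply: (subspaceD N_subspace) => //.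
  by rewrite PM cmulA; apply: N_mul => //; exists p.2.
rewrite -cmulBr -(linB linP); apply: (le_lt_trans (nm_cmul _ _)).
have := ler_wpM2l (nm_ge0 w) (star_hom_bounded hPsi (z - comb TA s)).
by have := ler_wpM2l (nm_ge0 w) (ltW zs); lra.
Qed.

(** The [w] for which [w] and [star w] both multiply [N] into itself form a C*-subalgebra [S]. It
    contains the generators of [OY] because [BA] lies in [A], [YA] in [X], and [star (TY y)] times
    [TB (psiA a)] is the adjoint of the image of [a^* y]. The other side follows by taking
    adjoints. *)
Lemma ideal_range_Psi : cstar_ideal (range Psi).
Proof.
have [_ _ PS] := hPsi; have [[_ [_ BM BS]] Yr Yl _ _] := covY.
have Nl w z : N (cmul w (Psi z)).
  pose S w := (forall z, N (cmul w (Psi z))) /\ (forall z, N (cmul (star w) (Psi z))).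
  suff : S w by case=> h _; exact: h.
  have cN z' : closed [set w' | N (cmul w' (Psi z'))].
    apply: (@closed_lipschitz_preimage _ _ _ (cmul^~ (Psi z')) (nm (Psi z'))) N_closed.
      exact: nm_ge0.
    by move=> u v /=; rewrite -cmulBl mulrC nm_cmul.
  have [_ gen _] := HOY.
  have : smallest (@cstar_subalgebra R OY) (range TY `|` range TB) w by rewrite gen.
  move/(_ S); apply; split; [split|].
  - apply: nm_closed => v h; split=> z';
      apply: (closed_nm (cN z')) => e /h[u [uS usS] uv].
      by exists u => //; exact: uS.
    by exists (star u); [exact: usS | rewrite -starB nm_star].
  - split=> [|k u v [uS usS] [vS vsS]].
      by split=> z'; rewrite ?star0 cmul0l; case: N_subspace.
    have [_ ND] := N_subspace.
    by split=> z'; rewrite ?star_antilinear cmulDl cmulZl; apply: ND.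
  - move=> u v [uS usS] [vS vsS]; split=> z'.
      by rewrite -cmulA; have [z'' _ <-] := vS z'.
    by rewrite starM -cmulA; have [z'' _ <-] := usS z'.
  - by move=> u [uS usS]; split=> z'; rewrite ?starK.
  - have NB b z' : N (cmul (TB b) (Psi z')).
      apply: N_absorb => a; rewrite PsiA -BM.
      have [|a' aE] := @qB_eq0 (cmul b (psiA a)).
        have [[_ [_ qM _]] _ _ _ _] := qmorph.
        by rewrite qM qB_psiA cmul0r.
      by rewrite -aE -PsiA; exists (TA a').
    move=> _ [[y _ <-]|[b _ <-]]; split=> z'; rewrite -?BS; [..|exact: NB|exact: NB].
      apply: N_absorb => a; rewrite PsiA -Yr.
      by have [x <-] := ract_psiA y a; rewrite -PsiX; exists (TX x).
    apply: N_absorb => a; rewrite PsiA.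
    have [[_ [_ _ psiS]] _ _ _ _] := morph.
    rewrite -[TB _]starK -starM -BS -psiS -Yl.
    have [x <-] := lact_psiA (star a) y.
    by rewrite -PsiX -PS; exists (star (TX x)).
split=> // [w _ [z _ <-]|w v]; first exact: Nl.
move=> /N_star[z _ zw]; rewrite -[cmul _ _]starK starM -zw.
exact/N_star/Nl.
Qed.

Lemma Q_Psi z : Q (Psi z) = 0.
Proof.
have [[linZ [linE _ _]] _ _ _ _] := covZ.
have /(congr1 (@^~ z)) // : Q \o Psi = fun=> 0.
apply: (cuntz_pimsner_eq HOX (star_hom_comp hPsi hQ) star_hom0).
- by apply/funext => x; rewrite /= PsiX QY qY_psiX (lin0 linZ).
- by apply/funext => a; rewrite /= PsiA QB qB_psiA (lin0 linE).
Qed.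

Section FromQuotient.
Context {D : cstarAlgType R} {p : OY -> D}.
Hypothesis Hp : cstar_quotient N p.

Let hp : star_hom p. Proof. by case: Hp. Qed.

Let p_Psi z : p (Psi z) = 0.
Proof.
have [_ _ [_ _ ker _ _]] := Hp.
have : N (Psi z) by exists z.
by rewrite -ker.
Qed.

Lemma quotient_factor : exists2 Phi : OZ -> D, star_hom Phi & Phi \o Q = p.
Proof.
have [linp pM pS] := hp.
have [[linY [linB' BM BS]] Yr Yl Yrip Ylip] := covY.
have [[linqY [linqB qM qS]] qr ql qrip qlip] := qmorph.
have [_ [_ surjY _ _ _] [_ _ [_ surjB _ _ _]]] := Hquo.
have surjY' z : exists y, qY y = z.
  have : range qY z by rewrite surjY.
  by case=> y _ <-; exists y.
have surjB' e : exists b, qB b = e.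
  have : range qB e by rewrite surjB.
  by case=> b _ <-; exists b.
(* Arbitrary sections; [tZE] and [tEE] show that [p] erases the choice. *)
have [sY sYK] := choice surjY'; have [sB sBK] := choice surjB'.
pose tZ z := p (TY (sY z)); pose tE e := p (TB (sB e)).
have tZE y : tZ (qY y) = p (TY y).
  apply/subr0_eq; rewrite /tZ -(linB linp) -(linB linY).
  have [|x <-] := @qY_eq0 (sY (qY y) - y).
    by rewrite (linB linqY) sYK subrr.
  by rewrite -PsiX p_Psi.
have tEE b : tE (qB b) = p (TB b).
  apply/subr0_eq; rewrite /tE -(linB linp) -(linB linB').
  have [|a <-] := @qB_eq0 (sB (qB b) - b).
    by rewrite (linB linqB) sBK subrr.
  by rewrite -PsiA p_Psi.
have cov : covariant_rep tZ tE.
  split; first split; [|split|..].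
  - move=> k u v; rewrite -(sYK u) -(sYK v) -linqY !tZE.
    by rewrite linY linp.
  - move=> k u v; rewrite -(sBK u) -(sBK v) -linqB !tEE.
    by rewrite linB' linp.
  - by move=> u v; rewrite -(sBK u) -(sBK v) -qM !tEE BM pM.
  - by move=> u; rewrite -(sBK u) -qS !tEE BS pS.
  - by move=> u v; rewrite -(sYK u) -(sBK v) -qr !tZE tEE Yr pM.
  - by move=> u v; rewrite -(sBK u) -(sYK v) -ql !tZE tEE Yl pM.
  - by move=> u v; rewrite -(sYK u) -(sYK v) -qrip !tZE tEE Yrip pM pS.
  - by move=> u v; rewrite -(sYK u) -(sYK v) -qlip !tZE tEE Ylip pM pS.
have [_ _ univ] := HOZ; have [Phi [hPhi PhiZ PhiE]] := univ _ _ _ cov.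
exists Phi => //.
apply: (cuntz_pimsner_eq HOY (star_hom_comp hQ hPhi) hp).
- apply/funext => y; rewrite /= QY -tZE.
  by have := congr1 (@^~ (qY y)) PhiZ.
- apply/funext => b; rewrite /= QB -tEE.
  by have := congr1 (@^~ (qB b)) PhiE.
Qed.

Lemma quotient_kernel v : Q v = 0 -> range Psi v.
Proof.
have [Phi [linPhi _ _] PhiQ] := quotient_factor => Qv.
have [_ _ [_ _ ker _ _]] := Hp; rewrite -/N -ker /= -PhiQ /= Qv.
exact: lin0.
Qed.

(** [Q] vanishes on [N] and so descends to [Q'] on [D]. The composite [Q' \o Phi] fixes the
    generators of [OZ], hence is the identity, and its values are values of [Q]. *)
Lemma quotient_surjective : range Q = setT.
Proof.
have [Phi hPhi PhiQ] := quotient_factor.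
have PhiQE v : Phi (Q v) = p v by rewrite -PhiQ.
have [_ [linp pM pS] [_ surj ker _ _]] := Hp.
have [linQ QM QS] := hQ.
have /choice[s sK] d : exists v, p v = d.
  have : range p d by rewrite surj.
  by case=> v _ <-; exists v.
pose Q' d := Q (s d).
have Q'p v : Q' (p v) = Q v.
  apply/subr0_eq; rewrite /Q' -(linB linQ).
  have : (p @^-1` [set 0]) (s (p v) - v) by rewrite /= (linB linp) sK subrr.
  by rewrite ker => -[z _ <-]; exact: Q_Psi.
have hQ' : star_hom Q'.
  split.
  - by move=> k u v; rewrite -(sK u) -(sK v) -linp !Q'p linQ.
  - by move=> u v; rewrite -(sK u) -(sK v) -pM !Q'p QM.
  - by move=> u; rewrite -(sK u) -pS !Q'p QS.
have [_ [_ surjY _ _ _] [_ _ [_ surjB _ _ _]]] := Hquo.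
have Q'Phi : Q' \o Phi = idfun.
  apply: (cuntz_pimsner_eq HOZ (star_hom_comp hPhi hQ') star_hom_id).
  - apply/funext => z; have : range qY z by rewrite surjY.
    case=> y _ <-; rewrite /= -QY PhiQE.
    exact: Q'p.
  - apply/funext => e; have : range qB e by rewrite surjB.
    case=> b _ <-; rewrite /= -QB PhiQE.
    exact: Q'p.
apply/seteqP; split=> // w _; exists (s (Phi w)) => //.
by have := congr1 (@^~ w) Q'Phi.
Qed.

(** [Phi] is onto because [p] is. If [Phi] kills [Q t] then [p t = 0], so [t] lies in [N] and
    [Q t = 0]; all of [OZ] is of the form [Q t]. *)
Lemma quotient_isomorphic : cstar_isomorphic OZ D.
Proof.
have [Phi hPhi PhiQ] := quotient_factor; exists Phi => //.
have PhiQE v : Phi (Q v) = p v by rewrite -PhiQ.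
have [_ _ [_ surj ker _ _]] := Hp; have [linPhi _ _] := hPhi.
have [linQ _ _] := hQ; have [linp _ _] := hp.
have /choice[g gK] d : exists w, Phi w = d.
  have : range p d by rewrite surj.
  by case=> v _ <-; exists (Q v).
exists g => // w; have inj u v : Phi u = Phi v -> u = v.
  move=> uv; apply/subr0_eq.
  have : range Q (u - v) by rewrite quotient_surjective.
  case=> t _ tE; rewrite -tE.
  have : (p @^-1` [set 0]) t by rewrite /= -PhiQE tE (linB linPhi) uv subrr.
  by rewrite ker => -[z _ <-]; exact: Q_Psi.
by apply: inj; rewrite gK.
Qed.

End FromQuotient.

End ExactSequence.

Theorem corollary4p5 (R : realType) (A B E : cstarAlgType R)
    (X : hilbertBimodType A) (Y : hilbertBimodType B) (Z : hilbertBimodType E)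
    (psiX : X -> Y) (psiA : A -> B) (qY : Y -> Z) (qB : B -> E)
    (OX OY OZ : cstarAlgType R)
    (TX : X -> OX) (TA : A -> OX) (TY : Y -> OY) (TB : B -> OY)
    (TZ : Z -> OZ) (TE : E -> OZ)
    (Hext : bimod_extension psiX psiA)
    (Hquo : bimod_quotient psiX psiA qY qB)
    (HOX : cuntz_pimsner TX TA) (HOY : cuntz_pimsner TY TB)
    (HOZ : cuntz_pimsner TZ TE) :
  exists (Psi : OX -> OY) (Q : OY -> OZ),
    [/\ induced_hom TX TA TY TB psiX psiA Psi,
        induced_hom TY TB TZ TE qY qB Q,
        cstar_short_exact Psi Q,
        exists (D : cstarAlgType R) (p : OY -> D), cstar_quotient (range Psi) p &
        forall (D : cstarAlgType R) (p : OY -> D),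
          cstar_quotient (range Psi) p -> cstar_isomorphic OZ D].
Proof.
have [morph _ _ _] := Hext; have [qmorph _ _] := Hquo.
have [covY _ _] := HOY; have [covZ _ _] := HOZ.
have [Psi HPsi] := induced_hom_exists morph HOX covY.
have [Q HQ] := induced_hom_exists qmorph HOY covZ.
have [[hPsi _ _] _] := HPsi; have [[hQ _ _] _] := HQ.
have idN := ideal_range_Psi Hext Hquo HOX HOY HPsi.
(* A quotient is needed already for exactness: the kernel and the range of [Q] are computed through
   it. *)
have [D [p Hp]] : exists (D : cstarAlgType R) (p : OY -> D),
    cstar_quotient (range Psi) p.
  apply: cstar_quotient_exists => // _ [z _ <-].
  by have [_ _ PS] := hPsi; exists (star z).
exists Psi, Q; split=> //; last 2 first.
- by exists D, p.
- by move=> D' p' Hp'; exact: (quotient_isomorphic Hquo HOX HOY HOZ HPsi HQ Hp').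
split=> //.
- exact: (Psi_inj Hext Hquo HOX HOY HPsi).
- apply/seteqP; split=> [_ [z _ <-]|v]; first exact: (Q_Psi Hquo HOX HOZ HPsi HQ).
  exact: (quotient_kernel Hquo HOY HOZ HPsi HQ Hp).
- exact: (quotient_surjective Hquo HOX HOY HOZ HPsi HQ Hp).
Qed.
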